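(* Let $d>e\geq 1$ be integers. There is a constant $B=B(d,e)$ with the following property. Let $a_1,\dots,a_{d-1},b_1,\dots,b_{e-1}\in\mathbb{C}$ be such that the correspondence \[y^e+b_{e-1}y^{e-1}+\cdots+b_1y=x^d+a_{d-1}x^{d-1}+\cdots+a_1x\] is postcritically constrained. Then every $a_i$ and every $b_j$ is an algebraic number, and $h(a_i)\leq B$, $h(b_j)\leq B$, where $h$ is the absolute logarithmic Weil height. In particular, for every $D\geq 1$ there are only finitely many postcritically constrained correspondences of this form whose coefficients $a_i,b_j$ all have algebraic degree at most $D$.
   Context: Let $k$ be an algebraically closed field and $f,g\in k[z]$ with $\deg f=d>\deg g=e\geq 1$. The correspondence defined by $g(y)=f(x)$ is the curve $C=\{(a,b)\in k^2: g(b)=f(a)\}$. A point $a\in k$ is a critical point of $C$ if $f'(a)=0$, or if $g'(b)=0$ for some $b\in k$ with $g(b)=f(a)$. A path is a sequence $(x_n)_{n\geq 0}$ in $k$ with $(x_n,x_{n+1})\in C$ for all $n\ge 0$; it starts at $x_0$. The shift $\sigma$ sends the path $(x_n)_{n\ge0}$ to $(x_{n+1})_{n\ge0}$. A path $P$ is preperiodic if $\sigma^n(P)=\sigma^m(P)$ for some $n\neq m$. The correspondence $C$ is postcritically constrained (PCC) if every critical point of $C$ is the starting point of at least one preperiodic path. *)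

(* Defs.v *)
From HB Require Import structures.
From mathcomp Require Import all_boot all_order all_algebra all_field.
Set Implicit Arguments. Unset Strict Implicit. Unset Printing Implicit Defensive.
Import Order.TTheory GRing.Theory Num.Theory.
Local Open Scope ring_scope.

Section Corr.
Variable k : fieldType.

Definition in_corr (f g : {poly k}) (x y : k) : Prop := g.[y] = f.[x].

Definition critical_point (f g : {poly k}) (a : k) : Prop :=
  (f^`()).[a] = 0 \/ exists b : k, g.[b] = f.[a] /\ (g^`()).[b] = 0.

Definition is_path (f g : {poly k}) (P : nat -> k) : Prop :=
  forall n, in_corr f g (P n) (P n.+1).

Definition preperiodic (P : nat -> k) : Prop :=
  exists n m : nat, n <> m /\ forall j, P (n + j)%N = P (m + j)%N.

Definition PCC (f g : {poly k}) : Prop :=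
  forall a, critical_point f g a ->
    exists P : nat -> k, is_path f g P /\ P 0%N = a /\ preperiodic P.

Definition normpoly (d : nat) (a : nat -> k) : {poly k} :=
  'X^d + \sum_(1 <= i < d) a i *: 'X^i.

Definition algebraic (x : k) : Prop :=
  exists p : {poly rat}, p != 0 /\ root (map_poly (fun q : rat => ratr q : k) p) x.

Definition alg_deg_le (D : nat) (x : k) : Prop :=
  exists p : {poly rat}, p != 0 /\ (size p <= D.+1)%N /\
    root (map_poly (fun q : rat => ratr q : k) p) x.

Definition int_minpoly (q : {poly int}) (x : k) : Prop :=
  [/\ zcontents q = 1, 0 < lead_coef q,
      irreducible_poly (map_poly (fun z : int => z%:~R : rat) q) &
      root (map_poly (fun z : int => z%:~R : k) q) x].
End Corr.

Definition mahler_le (q : {poly int}) (c : algC) : Prop :=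
  forall r : seq algC,
    map_poly (fun z : int => z%:~R : algC) q =
      (lead_coef q)%:~R *: \prod_(z <- r) ('X - z%:P) ->
    `|(lead_coef q)%:~R : algC| * \prod_(z <- r) Num.max 1 `|z| <= c.

(* Multiplicative Weil height H(x) = M(q)^(1/deg x) is at most B, i.e.
   h(x) <= log B: M(q) <= B^deg q, q the minimal polynomial of x. *)
Definition height_le (k : fieldType) (B : nat) (x : k) : Prop :=
  forall q : {poly int}, int_minpoly q x ->
    mahler_le q ((B%:R : algC) ^+ (size q).-1).

(* Main.v *)
Require Import Defs.
From HB Require Import structures.
From mathcomp Require Import all_boot all_order all_algebra all_field.
From mathcomp Require Import boolp classical_sets.
From mathcomp Require Import ring zify.
Import Order.TTheory GRing.Theory Num.Theory.
Set Implicit Arguments. Unset Strict Implicit. Unset Printing Implicit Defensive.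
Local Open Scope ring_scope.

(** Call "size" a multiplicative total preorder on the field with an element
    kap such that x, y << z implies x + y << kap z.  The absolute value of algC
    (kap = M) and any valuation ring O (x << y iff x = c y with c in O,
    kap = 1/M) are sizes for M = (d+1)!.  One argument thus covers
    all places, good and bad: if every critical point starts a preperiodic path
    then all coefficients are << kap^E, with E depending on d and e only.

    On a preperiodic path take a point of maximal size; since g(y) = f(x) and
    d > e, it cannot be much larger than the roots of f and g allow.  On the
    other hand a polynomial with root 0 and a root of size R has a critical
    value of size at least R^d up to a power of kap, which makes the path of a
    suitable critical point too large unless all roots are << kap^E.

    Applied to all valuation rings of k this gives that M^E a_i is integral over
    Z; applied to algC, after transporting the correspondence along an embedding
    of a number field, it bounds all conjugates of a_i by M^E.  Hence the
    leading coefficient of the minimal polynomial divides a power of M^E, its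
    Mahler measure is at most M^(2E deg), and Northcott's argument applies. *)

(** * Sizes *)

Record is_size (d : nat) (k : fieldType) (le : k -> k -> Prop) (kap : k) : Prop :=
  IsSize {
    sle_trans : forall y x z, le x y -> le y z -> le x z;
    sle_total : forall x y, le x y \/ le y x;
    sle_mul : forall x y u v, le x y -> le u v -> le (x * u) (y * v);
    sle_le0 : forall x, le x 0 -> x = 0;
    sle_ge0 : forall x, le 0 x;
    sle_1kap : le 1 kap;
    sle_add : forall x y z, le x z -> le y z -> le (x + y) (kap * z);
    sle_nat : forall n, (0 < n <= d)%N -> le 1 (kap * n%:R) }.

Section SizeTheory.
Variables (d : nat) (k : fieldType) (le : k -> k -> Prop) (kap : k).
Hypothesis S : is_size d le kap.

Local Notation "x ≼ y" := (le x y) (at level 70, no associativity).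

Lemma sle_refl x : x ≼ x.
Proof. by case: (sle_total S x x). Qed.

Lemma kap_neq0 : kap != 0.
Proof.
apply/eqP => k0; have := sle_1kap S; rewrite k0 => /(sle_le0 S)/eqP.
by rewrite oner_eq0.
Qed.

Lemma sle_eq0 x y : x ≼ y -> x != 0 -> y != 0.
Proof. by move=> xy; apply: contra_neq => y0; rewrite y0 in xy; apply: (sle_le0 S). Qed.

Lemma sle_mul2r z x y : x ≼ y -> x * z ≼ y * z.
Proof. by move=> xy; apply: sle_mul S _ _ _ _ xy (sle_refl z). Qed.

Lemma sle_mul2l z x y : x ≼ y -> z * x ≼ z * y.
Proof. by move=> xy; apply: sle_mul S _ _ _ _ (sle_refl z) xy. Qed.

Lemma sle_cancel z x y : z != 0 -> z * x ≼ z * y -> x ≼ y.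
Proof. by move=> z0 /(sle_mul2l z^-1); rewrite !mulKf. Qed.

Lemma sle_inv x y : x != 0 -> x ≼ y -> y^-1 ≼ x^-1.
Proof.
move=> x0 xy; have y0 := sle_eq0 xy x0.
by apply: (sle_cancel (mulf_neq0 x0 y0)); rewrite mulfK // mulrAC mulfV // mul1r.
Qed.

Lemma sle_exp n x y : x ≼ y -> x ^+ n ≼ y ^+ n.
Proof.
move=> xy; elim: n => [|n IH]; first exact: sle_refl.
by rewrite !exprS; exact: sle_mul S _ _ _ _ xy IH.
Qed.

Lemma sle_root n x y : (0 < n)%N -> x ^+ n ≼ y ^+ n -> x ≼ y.
Proof.
case: n => // n _ xyn; case: (sle_total S x y) => // yx.
have [y0|y0] := eqVneq y 0.
  rewrite y0 expr0n /= in xyn; have /eqP := sle_le0 S xyn.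
  by rewrite expf_eq0 /= => /eqP ->; exact: sle_ge0 S _.
apply: (sle_cancel (expf_neq0 n y0)); rewrite -exprSr.
apply: sle_trans S _ _ _ _ xyn; rewrite exprSr.
by apply: sle_mul2r; apply: sle_exp.
Qed.

Lemma sle_kapX n : 1 ≼ kap ^+ n.
Proof. by rewrite -(expr1n _ n); apply: sle_exp; exact: sle_1kap S. Qed.

Lemma sle_kapM n x : x ≼ kap ^+ n * x.
Proof. by rewrite -{1}[x]mul1r; apply/sle_mul2r/sle_kapX. Qed.

Lemma sle_kap_wide m n x y : (m <= n)%N -> x ≼ kap ^+ m * y -> x ≼ kap ^+ n * y.
Proof.
move=> mn xy; apply: sle_trans S _ _ _ xy _; rewrite -(subnK mn) exprD -mulrA.
exact: sle_kapM.
Qed.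

Lemma sle_kap_trans m n x y z : x ≼ kap ^+ m * y -> y ≼ kap ^+ n * z ->
  x ≼ kap ^+ (m + n) * z.
Proof.
move=> xy yz; apply: sle_trans S _ _ _ xy _; rewrite exprD -mulrA.
exact: sle_mul2l.
Qed.

Lemma sle_kap_exp m n x y : x ≼ kap ^+ m * y -> x ^+ n ≼ kap ^+ (m * n) * y ^+ n.
Proof. by move=> xy; rewrite exprM -exprMn; apply: sle_exp. Qed.

Lemma sle_opp1 : -1 ≼ 1.
Proof.
case: (sle_total S (-1) 1) => // /(sle_mul2l (-1)).
by rewrite mulr1 mulrNN mulr1.
Qed.

Lemma sle_opp x : - x ≼ x.
Proof. by have := sle_mul2r x sle_opp1; rewrite mulN1r mul1r. Qed.

Lemma sle_oppl x y : x ≼ y -> - x ≼ y.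
Proof. exact: sle_trans S _ _ _ (sle_opp x). Qed.

Lemma sle_sub x y z : x ≼ z -> y ≼ z -> x - y ≼ kap * z.
Proof. by move=> xz yz; apply: sle_add S _ _ _ xz _; apply: sle_oppl. Qed.

(** Substitute for the reverse triangle inequality: in each use one case is the wanted estimate and
    the other leads directly to the final conclusion. *)
Lemma sle_split x y : x + y ≼ kap * x \/ x + y ≼ kap * y.
Proof.
case: (sle_total S x y) => h; [right|left].
  exact: sle_add S _ _ _ h (sle_refl y).
exact: sle_add S _ _ _ (sle_refl x) h.
Qed.

Lemma sle_sum (I : eqType) (s : seq I) (F : I -> k) z :
  (forall i, i \in s -> F i ≼ z) -> \sum_(i <- s) F i ≼ kap ^+ size s * z.
Proof.
elim: s => [|a s IH] Fz; first by rewrite big_nil; exact: sle_ge0 S _.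
rewrite big_cons /= exprS -mulrA; apply: sle_add S _ _ _ _ _.
  by apply: (sle_kap_wide (leq0n _)); rewrite expr0 mul1r; apply/Fz/mem_head.
by apply: IH => i si; apply: Fz; rewrite inE si orbT.
Qed.

Lemma sle_sum_cond (I : finType) (P : pred I) (F : I -> k) z :
  (forall i, P i -> F i ≼ z) -> \sum_(i | P i) F i ≼ kap ^+ #|I| * z.
Proof.
move=> Fz; rewrite big_mkcond -big_enum cardT; apply: sle_sum => i _.
by case: ifP => [/Fz //|_]; exact: sle_ge0 S _.
Qed.

Lemma sle_prod (I : eqType) (s : seq I) (F G : I -> k) :
  (forall i, i \in s -> F i ≼ G i) -> \prod_(i <- s) F i ≼ \prod_(i <- s) G i.
Proof.
elim: s => [|a s IH] Fz; first by rewrite !big_nil; exact: sle_refl.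
rewrite !big_cons; apply: sle_mul S _ _ _ _ _ _; first exact/Fz/mem_head.
by apply: IH => i si; apply: Fz; rewrite inE si orbT.
Qed.

Lemma sle_prod_const (I : eqType) (s : seq I) (F : I -> k) z :
  (forall i, i \in s -> F i ≼ z) -> \prod_(i <- s) F i ≼ z ^+ size s.
Proof.
move=> Fz; apply: sle_trans S _ _ _ (sle_prod (G := fun=> z) Fz) _.
by rewrite big_const_seq count_predT -Monoid.iteropE; exact: sle_refl.
Qed.

Lemma const_sle_prod (I : eqType) (s : seq I) (F : I -> k) z :
  (forall i, i \in s -> z ≼ F i) -> z ^+ size s ≼ \prod_(i <- s) F i.
Proof.
move=> Fz; apply: sle_trans S _ _ _ _ (sle_prod (F := fun=> z) Fz).
by rewrite big_const_seq count_predT -Monoid.iteropE; exact: sle_refl.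
Qed.

Lemma sle_max (I : eqType) (s : seq I) (F : I -> k) :
  s != [::] -> exists2 i, i \in s & forall j, j \in s -> F j ≼ F i.
Proof.
elim: s => // a [|b s] IH _.
  by exists a => [|j]; rewrite ?mem_head // inE => /eqP ->; exact: sle_refl.
have [//|i si Fi] := IH.
case: (sle_total S (F a) (F i)) => h.
  exists i => [|j]; first by rewrite in_cons si orbT.
  by rewrite in_cons => /orP[/eqP ->|/Fi].
exists a => [|j]; first exact: mem_head.
rewrite in_cons => /orP[/eqP ->|/Fi Fj]; first exact: sle_refl.
exact: sle_trans S _ _ _ Fj h.
Qed.

Lemma sle_min (I : eqType) (s : seq I) (F : I -> k) :
  s != [::] -> exists2 i, i \in s & forall j, j \in s -> F i ≼ F j.
Proof.
elim: s => // a [|b s] IH _.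
  by exists a => [|j]; rewrite ?mem_head // inE => /eqP ->; exact: sle_refl.
have [//|i si Fi] := IH.
case: (sle_total S (F a) (F i)) => h; last first.
  exists i => [|j]; first by rewrite in_cons si orbT.
  by rewrite in_cons => /orP[/eqP ->|/Fi].
exists a => [|j]; first exact: mem_head.
rewrite in_cons => /orP[/eqP ->|/Fi Fj]; first exact: sle_refl.
exact: sle_trans S _ _ _ h Fj.
Qed.

(* Final move in every branch of the cluster argument: a smaller power of
   [eps] is bounded by a larger one. *)
Lemma sle_eps_cancel eps a b c : eps != 0 -> eps ≼ 1 -> (a < b)%N ->
  eps ^+ a ≼ kap ^+ c * eps ^+ b -> 1 ≼ kap ^+ c * eps.
Proof.
move=> e0 e1 ab h; apply: (sle_cancel (expf_neq0 a e0)); rewrite mulr1.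
apply: sle_trans S _ _ _ h _; rewrite mulrCA -exprSr; apply: sle_mul2l.
rewrite -(subnK ab) exprD -[X in _ ≼ X]mul1r; apply: sle_mul2r.
by rewrite -(expr1n _ (b - a.+1)); apply: sle_exp.
Qed.

End SizeTheory.

(** * A polynomial with distant roots has a large critical value *)

Lemma natr_neq0_pchar0 (k : fieldType) (ch0 : [pchar k] =i pred0) n :
  (0 < n)%N -> n%:R != 0 :> k.
Proof. by move=> n0; rewrite (pcharf0P k).1 // -lt0n. Qed.

Lemma closed_root (k : closedFieldType) (p : {poly k}) :
  (1 < size p)%N -> exists x, p.[x] = 0.
Proof.
move=> sp; have /closed_rootP[x /rootP] : size p != 1%N by rewrite neq_ltn sp orbT.
by exists x.
Qed.

(** Group equal nodes. The numerator then has degree one less than the number of distinct nodes and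
    leading coefficient d, nonzero in characteristic 0; two distinct nodes make it nonconstant. At a
    node only its own summand survives, and it is nonzero, so a root of the numerator avoids all
    nodes. *)
Lemma logderiv_root (k : closedFieldType) (ch0 : [pchar k] =i pred0) d
    (rho : 'I_d -> k) i j : rho i != rho j ->
  exists h, (forall l, h - rho l != 0) /\ \sum_l (h - rho l)^-1 = 0.
Proof.
move=> rij; pose c := codom rho; pose s := undup c.
have us : uniq s by apply: undup_uniq.
have sumc (F : k -> k) : \sum_(a <- s) F a *+ count_mem a c = \sum_l F (rho l).
  rewrite -[RHS]big_enum -(big_map rho predT F) -[map _ _]codomE.
  by rewrite -[RHS]big_undup_iterop_count.
(* [H] is the numerator, in lowest terms, of sum_l 1 / (X - rho l). *)
pose H := \sum_(a <- s) (\prod_(b <- rem a s) ('X - b%:P)) *+ count_mem a c.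
have mems l : rho l \in s by rewrite mem_undup codom_f.
have s2 : (1 < size s)%N.
  rewrite ltnNge; apply/negP => s1; move: rij (mems i) (mems j).
  case: (s) s1 => [|x [|y t]] //= _ /eqP rij; rewrite !inE => /eqP ri /eqP rj.
  by apply: rij; rewrite ri rj.
have d0 : (0 < d)%N by exact: leq_ltn_trans (leq0n i) (ltn_ord i).
have Hlead : H`_(size s).-1 = d%:R.
  transitivity (\sum_(a <- s) (1 : k) *+ count_mem a c).
    rewrite coef_sum; apply: eq_big_seq => a sa; rewrite coefMn; congr (_ *+ _).
    have <- : (size (\prod_(b <- rem a s) ('X - b%:P))).-1 = (size s).-1.
      by rewrite size_prod_XsubC size_rem.
    exact/monicP/monic_prod_XsubC.
  by rewrite sumc sumr_const card_ord.
have sH : (1 < size H)%N.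
  rewrite ltnNge; apply/negP => H1; have := natr_neq0_pchar0 ch0 d0.
  rewrite -Hlead nth_default ?eqxx //; apply: leq_trans H1 _.
  by case: (size s) s2 => [|[]].
have [h Hh] := closed_root sH.
have hs a : a \in s -> h != a.
  move=> sa; apply/eqP => ha; move: Hh; rewrite ha horner_sum (big_rem a) //=.
  rewrite [X in _ + X]big_seq [X in _ + X]big1 => [|b].
    rewrite addr0 hornerMn horner_prod => /eqP; rewrite -mulr_natr mulf_eq0 => /orP[].
      rewrite prodf_seq_eq0 => /hasP[b]; rewrite mem_rem_uniq // !inE => /andP[ba _] /=.
      by rewrite !hornerE subr_eq0 eq_sym (negPf ba).
    move: sa; rewrite mem_undup -has_pred1 has_count => /(natr_neq0_pchar0 ch0)/negPf.
    by move=> ->.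
  rewrite mem_rem_uniq // !inE => /andP[ba sb].
  rewrite hornerMn horner_prod (big_rem a) /= ?hornerE ?subrr ?mul0r ?mul0rn //.
  by rewrite mem_rem_uniq // !inE eq_sym ba.
exists h; split => [l|]; first by rewrite subr_eq0 hs.
rewrite -(sumc (fun a => (h - a)^-1)).
have P0 : \prod_(b <- s) (h - b) != 0.
  by rewrite prodf_seq_neq0; apply/allP => b sb /=; rewrite subr_eq0 hs.
apply: (mulfI P0); rewrite mulr0 -[RHS]Hh mulr_sumr horner_sum.
apply: eq_big_seq => a sa; rewrite hornerMn horner_prod (big_rem a) //=.
rewrite mulrnAr mulrAC divff ?subr_eq0 ?hs // mul1r; congr (_ *+ _).
by apply: eq_bigr => b _; rewrite !hornerE.
Qed.

Lemma deriv_prod_XsubC (k : fieldType) (I : Type) (s : seq I) (r : I -> k) x :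
  all (fun i => x != r i) s ->
  ((\prod_(i <- s) ('X - (r i)%:P))^`()).[x]
    = (\prod_(i <- s) (x - r i)) * \sum_(i <- s) (x - r i)^-1.
Proof.
elim: s => [|a s IH] /=; first by rewrite !big_nil derivC hornerC mulr0.
move=> /andP[xa xs]; rewrite !big_cons derivM derivXsubC mul1r hornerD hornerM IH //.
rewrite horner_prod hornerXsubC mulrDr; congr (_ + _); last by rewrite mulrA.
rewrite mulrAC divff ?mul1r ?subr_eq0 //.
by apply: eq_bigr => b _; rewrite !hornerE.
Qed.

(** For estimates proved index by index where a failure at any index already yields the goal [Q]. *)
Lemma all_or (I : eqType) (s : seq I) (P : I -> Prop) (Q : Prop) :
  (forall i, i \in s -> P i \/ Q) -> (forall i, i \in s -> P i) \/ Q.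
Proof.
elim: s => [|a s IH] H; first by left.
have [Pa|q] := H a (mem_head a s); last by right.
have [i si|Ps|q] := IH; [by apply: H; rewrite inE si orbT | | by right].
by left=> i; rewrite inE => /orP[/eqP ->|/Ps].
Qed.

(** A generous total of the powers of [kap] lost in [cluster_step], with [C] the exponent already
    spent on approximating the roots. *)
Definition step_exp (d C : nat) : nat :=
  (d + 2) * (d + 1) + 2 * d + (d + C + 4) * d + d + C + 3.

(** Consecutive values l', l satisfy l' (d + 1) < l, as [cluster_step] requires. *)
Fixpoint scale_exp (d m : nat) : nat :=
  if m is m'.+1 then (scale_exp d m' * d.+1).+1 else 1.

(** * Clusters of roots when all critical values are small *)

Section Cluster.
Variables (d : nat) (k : closedFieldType) (ch0 : [pchar k] =i pred0).
Variables (le : k -> k -> Prop) (kap : k).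
Hypothesis S : is_size d le kap.
Local Notation "x ≼ y" := (le x y) (at level 70, no associativity).

Variable r : 'I_d -> k.
Let f := \prod_i ('X - (r i)%:P).
Hypothesis r_le1 : forall i, r i ≼ 1.
Variable cs : seq k.
Hypothesis size_cs : size cs = d.-1.
Hypothesis deriv_f : f^`() = d%:R *: \prod_(c <- cs) ('X - c%:P).
Variables (eps : k) (L : nat).
Hypothesis eps0 : eps != 0.
Hypothesis eps1 : eps ≼ 1.
Hypothesis crit_small : forall c, c \in cs -> f.[c] ≼ eps ^+ L.

Let fE x : f.[x] = \prod_i (x - r i).
Proof. by rewrite horner_prod; apply: eq_bigr => i _; rewrite hornerXsubC. Qed.

(* The roots [r i] are clustered: they are close, at scale [eps ^+ l], to points
   [rho i] whose distinct values are separated at the much larger scale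
   [eps ^+ l'].  A zero [h] of sum 1 / (h - rho i) cannot be near any [rho i], so
   f'(h) / f(h) is small and some critical point c lies near [h], far from every
   root, which makes f(c) large. *)
Lemma cluster_step (rho : 'I_d -> k) C l l' i j :
  (l' * d.+1 < l)%N -> (l' * d < L)%N ->
  (forall i, r i - rho i ≼ kap ^+ C * eps ^+ l) ->
  rho i != rho j -> (forall i j, rho i != rho j -> eps ^+ l' ≼ rho i - rho j) ->
  1 ≼ kap ^+ (step_exp d C) * eps.
Proof.
move=> l'l l'L r_rho rij sep.
have kap0 := kap_neq0 S.
have d1 : (1 < d)%N.
  rewrite ltnNge; apply/negP => dle; case/negP: rij; apply/eqP; congr rho.
  by apply: ord_inj; have := ltn_ord i; have := ltn_ord j; lia.
have [h [hrho sum0]] := logderiv_root ch0 rij.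
have eta0 : eps ^+ l' != 0 by rewrite expf_neq0.
have finish a b E : (a < b)%N -> (E <= step_exp d C)%N ->
    eps ^+ a ≼ kap ^+ E * eps ^+ b -> 1 ≼ kap ^+ (step_exp d C) * eps.
  by move=> ab Ew /(sle_eps_cancel S eps0 eps1 ab); apply: (sle_kap_wide S).
have epsX n : eps ^+ n ≼ 1 by rewrite -(expr1n _ n); apply: (sle_exp S).
have rho_le m : rho m ≼ kap ^+ C.+1.
  rewrite -[rho m](subKr (r m)) exprS; apply: (sle_sub S).
    by rewrite -[kap ^+ C]mulr1; apply: sle_trans S _ _ _ (r_le1 m) _; apply: (sle_kapM S _ _).
  apply: sle_trans S _ _ _ (r_rho m) _.
  by rewrite -[X in _ ≼ X]mulr1; apply: (sle_mul2l S).
have [|i0 _ t_min] := sle_min S (fun m => h - rho m) (s := enum 'I_d).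
  by rewrite -size_eq0 size_enum_ord; lia.
have {}t_min m : h - rho i0 ≼ h - rho m by apply: t_min; rewrite mem_enum.
set t := h - rho i0 in t_min.
have t0 : t != 0 by apply: hrho.
(* In the vanishing sum the n terms equal to 1/t balance the others. Those have nodes separated from
   [rho i0] by eps^l', and t is the least distance from h to a node, so their denominators are at
   least eps^l' up to [kap]. Hence t is not small. *)
have t_low : eps ^+ l' ≼ kap ^+ d.+2 * t.
  pose n := #|[pred m | rho m == rho i0]|.
  have n_t : n%:R * t^-1 ≼ kap ^+ d * (kap * (eps ^+ l')^-1).
    move: sum0; rewrite (bigID [pred m | rho m == rho i0]) /=.
    rewrite (eq_bigr (fun=> t^-1)) => [|m /eqP ->//].
    rewrite sumr_const -/n => /eqP; rewrite mulr_natl addr_eq0 => /eqP ->.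
    apply: (sle_oppl S); rewrite -[X in kap ^+ X]card_ord; apply: (sle_sum_cond S) => m rm.
    rewrite -[kap]invrK -invfM; apply: (sle_inv S).
      by rewrite mulf_neq0 ?invr_neq0.
    rewrite mulrC; apply: (sle_cancel S kap0); rewrite mulrCA mulfV // mulr1.
    apply: sle_trans S _ _ _ (sep _ _ rm) _.
    have -> : rho m - rho i0 = t - (h - rho m) by rewrite /t; ring.
    by apply: (sle_sub S) => //; apply: (sle_refl S _).
  have n1 : (0 < n <= d)%N.
    apply/andP; split; first by apply/card_gt0P; exists i0; rewrite inE.
    by apply: leq_trans (max_card _) _; rewrite card_ord.
  have : t^-1 ≼ kap ^+ d.+2 * (eps ^+ l')^-1.
    rewrite -[t^-1]mul1r; apply: sle_trans S _ _ _ (sle_mul2r S _ (sle_nat S n1)) _.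
    have -> : kap ^+ d.+2 * (eps ^+ l')^-1 = kap * (kap ^+ d * (kap * (eps ^+ l')^-1)).
      by rewrite !exprS; ring.
    by rewrite -mulrA; apply: (sle_mul2l S).
  move=> /(sle_inv S (invr_neq0 t0)); rewrite invrK invfM invrK.
  by move=> /(sle_mul2l S (kap ^+ d.+2)); rewrite mulVKf ?expf_neq0.
(* Writing d as the sum of (h - rho m) / (h - rho m) and dropping h times the vanishing sum leaves
   minus the sum of rho m / (h - rho m), which is bounded by the nodes divided by t. *)
have t_up : t ≼ kap ^+ (d + C + 2).
  have d_t : d%:R ≼ kap ^+ d * (kap ^+ C.+1 * t^-1).
    have -> : d%:R = - \sum_m rho m * (h - rho m)^-1 :> k.
      apply/eqP; rewrite -addr_eq0; apply/eqP.
      transitivity (\sum_m h * (h - rho m)^-1); last by rewrite -mulr_sumr sum0 mulr0.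
      rewrite -[d in d%:R]card_ord -sumr_const -big_split /=; apply: eq_bigr => m _.
      by field; apply: hrho.
    apply: (sle_oppl S); rewrite -[X in kap ^+ X]card_ord; apply: (sle_sum_cond S) => m _.
    by apply: (sle_mul S) => //; apply: (sle_inv S).
  have : t * 1 ≼ t * (kap ^+ (d + C + 2) * t^-1).
    apply: (sle_mul2l S); apply: sle_trans S _ _ _ (sle_nat S (n := d) _) _.
      by rewrite leqnn (ltnW d1).
    have -> : kap ^+ (d + C + 2) * t^-1 = kap * (kap ^+ d * (kap ^+ C.+1 * t^-1)).
      have -> : (d + C + 2 = (d + C.+1).+1)%N by lia.
      by rewrite exprS exprD -!mulrA.
    exact: (sle_mul2l S).
  by rewrite mulr1 mulrCA mulfV // mulr1.
have h_up : h ≼ kap ^+ (d + C + 3).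
  have -> : h = t + rho i0 by rewrite /t subrK.
  rewrite addnS exprS; apply: (sle_add S) => //.
  rewrite -[X in _ ≼ X]mulr1; apply: (sle_kap_wide S) (_ : _ <= _)%N _; last first.
    by rewrite mulr1; exact: rho_le.
  lia.
have fh_up : f.[h] ≼ kap ^+ ((d + C + 4) * d).
  rewrite fE exprM -[X in _ ^+ X](size_enum_ord d) -big_enum; apply: (sle_prod_const S) => m _.
  rewrite addnS exprS; apply: (sle_sub S) => //.
  by apply: sle_trans S _ _ _ (r_le1 m) _; apply: (sle_kapX S _).
(* If [r m - rho m] dominated, t would be at most eps^l up to [kap], against [t_low]. *)
have [t_r|//] : (forall m, m \in enum 'I_d -> t ≼ kap * (h - r m)) \/
    1 ≼ kap ^+ (step_exp d C) * eps.
  apply: all_or => m _.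
  have e : h - rho m = (h - r m) + (r m - rho m) by ring.
  have := t_min m; rewrite e => tm.
  have [H|H] := sle_split S (h - r m) (r m - rho m).
    by left; apply: sle_trans S _ _ _ tm H.
  right; apply: (finish l' l (d.+2 + C.+1)%N).
  - by move: l'l; rewrite mulnS; lia.
  - by rewrite /step_exp; lia.
  apply: (sle_kap_trans S t_low _).
  rewrite exprS -mulrA; apply: sle_trans S _ _ _ tm _; apply: sle_trans S _ _ _ H _.
  by apply: (sle_mul2l S _ (r_rho m)).
have {}t_r m : t ≼ kap * (h - r m) by apply: t_r; rewrite mem_enum.
have hr m : h - r m != 0.
  by have := sle_eq0 S (t_r m) t0; rewrite mulf_eq0 negb_or => /andP[].
(* Subtracting the vanishing sum from f'(h) / f(h) leaves terms (r m - rho m) / ((h - r m)(h - rho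
   m)), each of size at most eps^l / t^2 up to [kap]. *)
have f'h : (f^`()).[h] ≼ kap ^+ ((d + C + 4) * d + (d + C + 1)) * (eps ^+ l * t ^- 2).
  rewrite deriv_prod_XsubC; last by apply/allP => m _; rewrite -subr_eq0.
  rewrite -fE exprD -mulrA; apply: (sle_mul S) => //.
  have -> : \sum_m (h - r m)^-1 =
      \sum_m (r m - rho m) * ((h - r m)^-1 * (h - rho m)^-1).
    rewrite -[LHS]subr0 -[X in _ - X]sum0 -sumrB; apply: eq_bigr => m _.
    by field; rewrite hr hrho.
  rewrite -addnA exprD -mulrA -[d in X in _ ≼ X]card_ord; apply: (sle_sum_cond S) => m _.
  have -> : kap ^+ (C + 1) * (eps ^+ l * t ^- 2) =
     (kap ^+ C * eps ^+ l) * ((kap * t^-1) * t^-1).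
    by rewrite exprD expr1 [t ^+ 2]expr2 invfM; ring.
  apply: (sle_mul S) => //; apply: (sle_mul S); last exact: (sle_inv S t0).
  rewrite -[kap]invrK -invfM; apply: (sle_inv S); first by rewrite mulf_neq0 ?invr_neq0.
  by apply: (sle_cancel S kap0); rewrite mulrA mulfV ?mul1r.
have [c ccs c_min] : exists2 c, c \in cs & forall c', c' \in cs -> h - c ≼ h - c'.
  by apply: (sle_min S (fun c => h - c)); rewrite -size_eq0 size_cs; lia.
(* The d - 1 differences from h to the critical points multiply to f'(h) / d, and h - c is the
   smallest of them. *)
have hc_up : (h - c) ^+ d.-1 ≼
    kap ^+ ((d + C + 4) * d + (d + C + 2)) * (eps ^+ l * t ^- 2).
  have -> : ((d + C + 4) * d + (d + C + 2) = ((d + C + 4) * d + (d + C + 1)).+1)%N by lia.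
  rewrite exprS -mulrA; apply: sle_trans S _ _ _ _ (sle_mul2l S _ f'h).
  rewrite deriv_f hornerZ horner_prod mulrA -size_cs.
  have -> : \prod_(c' <- cs) ('X - c'%:P).[h] = \prod_(c' <- cs) (h - c').
    by apply: eq_bigr => c' _; rewrite hornerXsubC.
  rewrite -[_ ^+ _]mul1r; apply: (sle_mul S); first by apply: sle_nat S _ _; lia.
  exact: (const_sle_prod S c_min).
(* If [h - c] dominated, [hc_up] would bound t^(d+1) = t^(d-1) t^2 by eps^l up to [kap]; with
   [t_low] this collides with l' (d + 1) < l. *)
have [t_c|//] : (forall m, m \in enum 'I_d -> t ≼ kap ^+ 2 * (c - r m)) \/
    1 ≼ kap ^+ (step_exp d C) * eps.
  apply: all_or => m _.
  have e : h - r m = (h - c) + (c - r m) by ring.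
  have := t_r m; rewrite e => tm.
  have [H|H] := sle_split S (h - c) (c - r m); last first.
    left; apply: sle_trans S _ _ _ tm _; rewrite expr2 -mulrA.
    exact: (sle_mul2l S _ H).
  have t_hc : t ≼ kap ^+ 2 * (h - c).
    by apply: sle_trans S _ _ _ tm _; rewrite expr2 -mulrA; apply: (sle_mul2l S _ H).
  right; apply: (finish (l' * d.+1)%N l
     (d.+2 * d.+1 + (2 * d.-1 + ((d + C + 4) * d + (d + C + 2))))%N) => //.
    by rewrite /step_exp; lia.
  rewrite exprM; apply: (sle_kap_trans S (sle_kap_exp S _ t_low) _).
  have -> : t ^+ d.+1 = t ^+ d.-1 * t ^+ 2 by rewrite -exprD; congr (_ ^+ _); lia.
  have -> : eps ^+ l = (eps ^+ l * t ^- 2) * t ^+ 2 by rewrite mulfVK ?expf_neq0.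
  rewrite [X in _ ≼ X]mulrA; apply: (sle_mul2r S).
  exact: (sle_kap_trans S (sle_kap_exp S _ t_hc) hc_up).
have {}t_c m : t ≼ kap ^+ 2 * (c - r m) by apply: t_c; rewrite mem_enum.
(* Every factor of f(c) is at least t up to [kap], so eps^(l' d) is at most f(c), hence at most
   eps^L, up to [kap]; now l' d < L concludes. *)
apply: (finish (l' * d)%N L (d.+2 * d + (2 * d))%N) => //.
  by rewrite /step_exp; lia.
rewrite exprM; apply: (sle_kap_trans S (sle_kap_exp S _ t_low) _).
apply: sle_trans S _ _ _ _ (sle_mul2l S _ (crit_small ccs)).
have -> : kap ^+ (2 * d) * f.[c] = \prod_(i <- enum 'I_d) (kap ^+ 2 * (c - r i)).
  by rewrite big_enum fE big_split /= prodr_const card_ord exprM.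
rewrite -[X in t ^+ X](size_enum_ord d); apply: (const_sle_prod S) => m _.
exact: t_c.
Qed.

Lemma leq_scale_exp m n : (m <= n)%N -> (scale_exp d m <= scale_exp d n)%N.
Proof.
move=> mn; rewrite -(subnK mn); elim: (n - m)%N => // x IH.
by apply: leq_trans IH _; rewrite addSn /=; rewrite mulnS; lia.
Qed.

(* Two values of [rho] that are too close for [cluster_step] are merged; the
   recursion in [scale_exp] keeps consecutive scales far enough apart. *)
Lemma cluster_ind (i0 i1 : 'I_d) m C (rho : 'I_d -> k) :
  r i0 = 0 -> r i1 = 1 -> (scale_exp d m <= L)%N ->
  (size (undup (codom rho)) <= m.+1)%N ->
  (forall i, r i - rho i ≼ kap ^+ C * eps ^+ scale_exp d m) ->
  1 ≼ kap ^+ step_exp d (C + m) * eps.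
Proof.
move=> r0 r1; elim: m C rho => [|m IH] C rho mL sz r_rho.
  (* A single cluster remains, so 1 is a difference of two errors of size eps. *)
  have rho01 : rho i0 = rho i1.
    have := codom_f rho i0; have := codom_f rho i1; rewrite -!(mem_undup (codom rho)).
    case: (undup _) sz => [|x [|y s]] //= _; rewrite !inE => /eqP -> /eqP -> //.
  have e : 1 = (r i1 - rho i1) - (r i0 - rho i0) by rewrite r0 r1 rho01; ring.
  have : 1 ≼ kap ^+ C.+1 * eps.
    by rewrite {1}e exprS -mulrA -(expr1 eps); apply: (sle_sub S); apply: r_rho.
  by apply: (sle_kap_wide S); rewrite /step_exp; nia.
have epsX n : eps ^+ n ≼ 1 by rewrite -(expr1n _ n); apply: (sle_exp S).
pose Q := 1 ≼ kap ^+ step_exp d (C + m.+1) * eps.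
have [sep|//] : (forall p, p \in enum {: 'I_d * 'I_d} ->
    rho p.1 != rho p.2 -> eps ^+ scale_exp d m ≼ rho p.1 - rho p.2) \/ Q.
  apply: all_or => -[i j] _ /=.
  have [->|rij] := eqVneq (rho i) (rho j); first by left=> /eqP.
  case: (sle_total S (eps ^+ scale_exp d m) (rho i - rho j)) => h; first by left.
  (* Moving the cluster at [rho i] to [rho j] removes one value; the error becomes of the coarser
     scale, at the cost of one more [kap]. *)
  right; pose rho' x := if rho x == rho i then rho j else rho x.
  rewrite /Q -addSnnS; apply: (IH _ rho').
  - by apply: leq_trans mL; apply: leq_scale_exp.
  - rewrite -ltnS; apply: leq_trans sz.
    have ic : rho i \in undup (codom rho) by rewrite mem_undup codom_f.
    rewrite -(prednK (n := size (undup (codom rho)))); last first.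
      by case: (undup _) ic.
    rewrite ltnS -(size_rem ic); apply: uniq_leq_size; first exact: undup_uniq.
    move=> _ /[!mem_undup] /codomP[x ->]; rewrite mem_rem_uniq ?undup_uniq // !inE.
    rewrite mem_undup /rho'; case: ifP => [_|->]; rewrite codom_f ?andbT //.
    by rewrite eq_sym.
  - move=> x; have e : r x - rho' x = (r x - rho x) + (rho x - rho' x) by ring.
    rewrite e exprS -mulrA; apply: (sle_add S).
      apply: sle_trans S _ _ _ (r_rho x) _; apply: (sle_mul2l S).
      rewrite /= -[X in _ ≼ X]mul1r.
      have -> : ((scale_exp d m * d.+1).+1 = (scale_exp d m * d).+1 + scale_exp d m)%N.
        by rewrite mulnS; lia.
      by rewrite exprD; apply: (sle_mul2r S).
    rewrite /rho'; case: ifP => [/eqP ->|_]; last by rewrite subrr; apply: sle_ge0 S _.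
    exact: sle_trans S _ _ _ h (sle_kapM S _ _).
(* All values are now separated. Either the roots 0 and 1 lie in different clusters and
   [cluster_step] applies, or their common cluster makes 1 small as before. *)
have [e|] := eqVneq (rho i0) (rho i1); last first.
  move=> rij; apply: (sle_kap_wide S (m := step_exp d C)); first by rewrite /step_exp; nia.
  apply: (cluster_step (l' := scale_exp d m) _ _ r_rho rij) => [||i j].
  - by rewrite /= ltnS.
  - by apply: leq_trans mL; rewrite /= ltnS leq_mul2l leqnSn orbT.
  - by apply: (sep (i, j)); rewrite mem_enum.
have e1 : 1 = (r i1 - rho i1) - (r i0 - rho i0) by rewrite r0 r1 e; ring.
apply: (sle_kap_wide S (m := C.+1)); first by rewrite /step_exp; nia.
rewrite {1}e1 exprS -mulrA.
have r_rho' i : r i - rho i ≼ kap ^+ C * eps.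
  apply: sle_trans S _ _ _ (r_rho i) _; apply: (sle_mul2l S).
  by rewrite /= exprS -[X in _ ≼ X]mulr1; apply: (sle_mul2l S).
by apply: (sle_sub S).
Qed.
End Cluster.

(** The estimate on [eps] is raised to the power [scale_exp d d], which turns [eps] into the
    critical value. *)
Definition crit_exp d := (step_exp d d * scale_exp d d)%N.

Lemma deriv_closed_split (k : closedFieldType) (ch0 : [pchar k] =i pred0) (f : {poly k}) d :
  (0 < d)%N -> f \is monic -> size f = d.+1 ->
  exists2 cs, size cs = d.-1 & f^`() = d%:R *: \prod_(c <- cs) ('X - c%:P).
Proof.
move=> d0 mf sf; have [cs fE] := closed_field_poly_normal f^`().
have co : (f^`())`_d.-1 = d%:R.
  rewrite coef_deriv prednK //; have := monicP mf.
  by rewrite /lead_coef sf /= => ->.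
have dn0 := natr_neq0_pchar0 ch0 d0.
have sd : size f^`() = d.
  have := lt_size_deriv (monic_neq0 mf); rewrite sf ltnS => le_d.
  apply/eqP; rewrite eqn_leq le_d leqNgt; apply/negP => h.
  by move: dn0; rewrite -co nth_default ?eqxx // -ltnS prednK.
have lc : lead_coef f^`() = d%:R by rewrite /lead_coef sd.
exists cs; last by rewrite {1}fE lc.
by move: sd; rewrite fE lc size_scale // size_prod_XsubC => <-.
Qed.

Lemma size_prod_XsubC_ord (R : idomainType) d (r : 'I_d -> R) :
  size (\prod_i ('X - (r i)%:P)) = d.+1.
Proof.
rewrite -big_enum /= -(big_map r predT (fun x => 'X - x%:P)).
by rewrite size_prod_XsubC size_map size_enum_ord.
Qed.

Section KeyLemma.
Variables (d : nat) (k : closedFieldType) (ch0 : [pchar k] =i pred0).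
Variables (le : k -> k -> Prop) (kap : k).
Hypothesis S : is_size d le kap.
Local Notation "x ≼ y" := (le x y) (at level 70, no associativity).

(** Take the critical point of largest value. That value is nonzero, because [logderiv_root]
    provides a critical point that is not a root. If it is at most 1, it is a power of some [eps]
    below 1, and clustering starts with each root as its own centre. *)
Lemma crit_value_unit (r : 'I_d -> k) i0 i1 (f := \prod_i ('X - (r i)%:P)) :
  r i0 = 0 -> r i1 = 1 -> (forall i, r i ≼ 1) ->
  exists2 c, (f^`()).[c] = 0 & 1 ≼ kap ^+ crit_exp d * f.[c].
Proof.
move=> r0 r1 r_le1; have d0 : (0 < d)%N by exact: leq_ltn_trans (leq0n i0) (ltn_ord i0).
have sf : size f = d.+1 by apply: size_prod_XsubC_ord.
have mf : f \is monic by apply: monic_prod_XsubC.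
have [cs size_cs deriv_f] := deriv_closed_split ch0 d0 mf sf.
have crit c : c \in cs -> (f^`()).[c] = 0.
  move=> ccs; rewrite deriv_f hornerZ horner_prod (big_rem c) //=.
  by rewrite hornerXsubC subrr mul0r mulr0.
have r01 : r i0 != r i1 by rewrite r0 r1 eq_sym oner_neq0.
have [h [hr sum0]] := logderiv_root ch0 r01.
have f'h : (f^`()).[h] = 0.
  by rewrite deriv_prod_XsubC ?sum0 ?mulr0 //; apply/allP => i _; rewrite -subr_eq0.
have hcs : h \in cs.
  move/eqP: f'h; rewrite deriv_f hornerZ mulf_eq0 (negPf (natr_neq0_pchar0 ch0 d0)) /=.
  by rewrite -/(root _ h) root_prod_XsubC.
have fh0 : f.[h] != 0.
  rewrite horner_prod prodf_seq_neq0; apply/allP => i _ /=.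
  by rewrite hornerXsubC.
have [|c ccs c_max] := sle_max S (fun c => f.[c]) (s := cs); first by case: (cs) hcs.
exists c; first exact: crit.
have fc0 : f.[c] != 0 by apply: (sle_eq0 S _ fh0); apply: c_max.
case: (sle_total S 1 f.[c]) => [fc1|fc1].
  exact: sle_trans S _ _ _ fc1 (sle_kapM S _ _).
have L0 : (0 < scale_exp d d)%N by case: (d).
have [eps epsE] : exists eps, eps ^+ scale_exp d d = f.[c].
  have [|x] := closed_root (p := 'X^(scale_exp d d) - (f.[c])%:P).
    by rewrite size_XnsubC.
  by rewrite !hornerE => /eqP; rewrite subr_eq0 => /eqP xE; exists x.
have eps0 : eps != 0 by apply: contra_neq fc0 => e0; rewrite -epsE e0 expr0n eqn0Ngt L0.
have eps1 : eps ≼ 1 by apply: (sle_root S L0); rewrite epsE expr1n.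
have crit_small c' : c' \in cs -> f.[c'] ≼ eps ^+ scale_exp d d.
  by rewrite epsE; apply: c_max.
have : 1 ≼ kap ^+ step_exp d (0 + d) * eps.
  apply: (cluster_ind ch0 S r_le1 size_cs deriv_f eps0 eps1 crit_small r0 r1 (leqnn _) (rho := r)).
    apply: leq_trans (size_undup _) _; rewrite size_codom card_ord leqnSn //.
  by move=> i; rewrite subrr; apply: sle_ge0 S _.
rewrite add0n => /(sle_kap_exp S (scale_exp d d)).
by rewrite expr1n epsE.
Qed.

(** Substituting aX, with a the largest root, divides all roots by a and the critical values by
    a^d. *)
Lemma crit_value_large (r : 'I_d -> k) i0 i1 (f := \prod_i ('X - (r i)%:P)) :
  r i0 = 0 -> r i1 != 0 -> (forall i, r i ≼ r i1) ->
  exists2 c, (f^`()).[c] = 0 & r i1 ^+ d ≼ kap ^+ crit_exp d * f.[c].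
Proof.
move=> r0 a0 r_le; set a := r i1 in a0 r_le *.
pose s i := r i / a.
have [|||c fc0 fc1] := @crit_value_unit s i0 i1.
- by rewrite /s r0 mul0r.
- by rewrite /s divff.
- by move=> i; rewrite /s -(divff a0); apply: (sle_mul2r S).
have e : f \Po (a *: 'X) = a ^+ d *: \prod_i ('X - (s i)%:P).
  rewrite rmorph_prod /= -[d in a ^+ d](card_ord d) -prodr_const -scaler_prod.
  apply: eq_bigr => i _; rewrite comp_polyB comp_polyX comp_polyC scalerBr.
  by congr (_ - _); rewrite -mul_polyC -polyCM /s mulrC mulfVK.
exists (a * c).
  have := congr1 (fun p : {poly k} => (p^`()).[c]) e.
  rewrite deriv_comp derivZ derivX alg_polyC hornerM hornerC derivZ [X in _ = X]hornerZ.
  rewrite fc0 mulr0 horner_comp hornerZ hornerX => /eqP.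
  by rewrite mulf_eq0 (negPf a0) orbF => /eqP.
have := congr1 (fun p : {poly k} => p.[c]) e.
rewrite horner_comp hornerZ hornerX hornerZ => ->.
by rewrite mulrCA -[X in X ≼ _]mulr1; apply: (sle_mul2l S).
Qed.
End KeyLemma.

(** * Roots and coefficients under the preperiodicity assumption *)

Lemma is_size_leq (d e : nat) (k : fieldType) (le : k -> k -> Prop) kap :
  (e <= d)%N -> is_size d le kap -> is_size e le kap.
Proof.
move=> ed [h1 h2 h3 h4 h5 h6 h7 h8]; split=> // n /andP[n0 ne].
by apply: h8; rewrite n0 (leq_trans ne).
Qed.

(** All that the bounds take from preperiodicity: the path has finitely many points, so one of them
    has maximal size. *)
Lemma preperiodic_finite (k : fieldType) (P : nat -> k) :
  preperiodic P -> exists2 m, (0 < m)%N & forall t, exists2 t', (t' < m)%N & P t = P t'.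
Proof.
move=> [n [m [nm PE]]]; wlog lt_nm : n m nm PE / (n < m)%N => [H|].
  have [lt|lt|//] := ltngtP n m; first exact: (H n m).
  by apply: (H m n) => // mn; apply: nm.
exists m; first exact: leq_ltn_trans lt_nm.
elim/ltn_ind => t IH; have [tm|mt] := ltnP t m; first by exists t.
have [|t' t'm E] := IH (n + (t - m))%N; first lia.
by exists t' => //; rewrite -E PE subnKC.
Qed.

Section NormPoly.
Variables (k : fieldType) (d : nat) (a : nat -> k).
Hypothesis d0 : (0 < d)%N.

Lemma size_normpoly_tail : (size (\sum_(1 <= i < d) a i *: 'X^i : {poly k})%R <= d)%N.
Proof.
rewrite big_nat_cond; apply: (big_ind (fun p : {poly k} => (size p <= d)%N)).
- by rewrite size_poly0.
- by move=> p q pd qd; apply: leq_trans (size_polyD _ _) _; rewrite geq_max pd.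
- move=> i; rewrite andbT => /andP[_ id]; apply: leq_trans (size_scale_leq _ _) _.
  by rewrite size_polyXn.
Qed.

Lemma size_normpoly : size (normpoly d a) = d.+1.
Proof. by rewrite size_polyDl size_polyXn // ltnS size_normpoly_tail. Qed.

Lemma monic_normpoly : normpoly d a \is monic.
Proof.
apply/monicP; rewrite lead_coefDl ?lead_coefXn //.
by rewrite size_polyXn ltnS size_normpoly_tail.
Qed.

Lemma normpoly_at0 : (normpoly d a).[0] = 0.
Proof.
rewrite /normpoly hornerD hornerXn expr0n eqn0Ngt d0 add0r horner_sum big_nat_cond big1 //.
by move=> i /andP[/andP[i1 _] _]; rewrite hornerZ hornerXn expr0n eqn0Ngt i1 mulr0.
Qed.

Lemma coef_normpoly i : (1 <= i < d)%N -> (normpoly d a)`_i = a i.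
Proof.
move=> /andP[i1 id]; rewrite /normpoly coefD coefXn ltn_eqF // add0r coef_sum.
rewrite (big_cat_nat i1 (ltnW id)) /= big_nat_cond big1 => [|j /andP[/andP[_ ji] _]].
  rewrite add0r big_ltn // coefZ coefXn eqxx mulr1 big_nat_cond big1 ?addr0 //.
  by move=> j /andP[/andP[ij _] _]; rewrite coefZ coefXn ltn_eqF // mulr0.
by rewrite coefZ coefXn gtn_eqF // mulr0.
Qed.

End NormPoly.

Lemma normpoly_roots (k : closedFieldType) d (a : nat -> k) : (0 < d)%N ->
  exists2 r : 'I_d -> k, normpoly d a = \prod_i ('X - (r i)%:P) & exists i, r i = 0.
Proof.
move=> d0; have [rs E] := closed_field_poly_normal (normpoly d a).
rewrite (monicP (monic_normpoly d a)) scale1r in E.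
have srs : size rs = d by have := size_normpoly d a; rewrite E size_prod_XsubC => -[].
have E' : normpoly d a = \prod_(i < d) ('X - (nth 0 rs i)%:P).
  by rewrite E (big_nth 0) big_mkord srs.
exists (fun i => nth 0 rs i) => //.
move/eqP: (normpoly_at0 a d0); rewrite E' horner_prod prodf_seq_eq0 => /hasP[i _ /=].
by rewrite hornerXsubC sub0r oppr_eq0 => /eqP; exists i.
Qed.

(** * Size of the points on a preperiodic path *)

Section Paths.
Variables (d e : nat) (k : closedFieldType) (ch0 : [pchar k] =i pred0).
Hypothesis (e0 : (0 < e)%N) (ed : (e < d)%N).
Variables (le : k -> k -> Prop) (kap : k).
Hypothesis S : is_size d le kap.
Local Notation "x ≼ y" := (le x y) (at level 70, no associativity).
Variables (r : 'I_d -> k) (s : 'I_e -> k) (i0 i1 : 'I_d) (j0 j1 : 'I_e).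
Let f := \prod_i ('X - (r i)%:P).
Let g := \prod_j ('X - (s j)%:P).
Hypothesis r0 : r i0 = 0.
Hypothesis s0 : s j0 = 0.
Hypothesis r_max : forall i, r i ≼ r i1.
Hypothesis s_max : forall j, s j ≼ s j1.
Let A := r i1.
Let G := s j1.

Let fE x : f.[x] = \prod_i (x - r i).
Proof. by rewrite horner_prod; apply: eq_bigr => i _; rewrite hornerXsubC. Qed.
Let gE x : g.[x] = \prod_j (x - s j).
Proof. by rewrite horner_prod; apply: eq_bigr => i _; rewrite hornerXsubC. Qed.

Lemma sle_expr_1 x n : 1 ≼ x -> 1 ≼ x ^+ n.
Proof. by move=> x1; rewrite -(expr1n _ n); apply: (sle_exp S). Qed.

Lemma sle_expr_self x n : (0 < n)%N -> 1 ≼ x -> x ≼ x ^+ n.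
Proof.
case: n => // n _ x1; rewrite exprS -{1}[x]mulr1.
by apply: (sle_mul2l S); apply: sle_expr_1.
Qed.

(* Since [s j0 = 0], one factor of [g.[y]] is exactly [y]. *)
Lemma sle_g y Y Z a : y ≼ kap ^+ a * Y -> y ≼ kap ^+ a * Z -> G ≼ Z ->
  g.[y] ≼ kap ^+ (a.+1 * e) * (Y * Z ^+ e.-1).
Proof.
move=> yY yZ GZ; rewrite gE (bigD1 j0) //= s0 subr0.
have -> : (a.+1 * e = a.+1 + a.+1 * e.-1)%N by rewrite -mulnS prednK.
rewrite exprD -mulrA mulrCA mulrA -mulrA [X in _ ≼ X]mulrCA.
have -> : kap ^+ a.+1 * (kap ^+ (a.+1 * e.-1) * (Y * Z ^+ e.-1)) =
   (kap ^+ a.+1 * Y) * (kap ^+ a.+1 * Z) ^+ e.-1.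
  by rewrite exprMn exprM; ring.
apply: (sle_mul S); first by apply: (sle_kap_wide S) yY.
have -> : e.-1 = #|[pred j : 'I_e | j != j0]|.
  by have := cardC1 j0; rewrite card_ord => <-; apply: eq_card => j.
rewrite -prodr_const.
elim/big_ind2: _ => [||j _].
- exact: sle_refl S _.
- by move=> *; apply: (sle_mul S).
- rewrite exprS -mulrA; apply: (sle_sub S) => //.
  apply: sle_trans S _ _ _ (s_max j) _; apply: sle_trans S _ _ _ GZ _.
  exact: (sle_kapM S).
Qed.

(** Let x be a point of maximal size and y its successor. Unless some root of f already dominates x,
    x^d is at most f(x) = g(y), hence at most Z^e with Z the larger of x and G, all up to [kap]. If
    Z = x, cancel x^e; if Z = G, use the assumed bound of G^e by W^d. *)
Lemma path_bound P W : is_path f g P -> preperiodic P ->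
  1 ≼ W -> A ≼ W -> G ^+ e ≼ W ^+ d -> forall n, P n ≼ kap ^+ (2 * d) * W.
Proof.
move=> pathP /preperiodic_finite[m m0 finP] W1 AW GW.
have [|t _ tmax] := sle_max S P (s := iota 0 m); first by rewrite -size_eq0 size_iota; lia.
have {tmax finP} xmax n : P n ≼ P t.
  by have [t' t'm ->] := finP n; apply: tmax; rewrite mem_iota.
suff : P t ≼ kap ^+ (2 * d) * W by move=> h n; apply: sle_trans S _ _ _ (xmax n) h.
set x := P t in xmax *; set y := P t.+1.
have gy : g.[y] = f.[x] by apply: pathP.
have [x_r|//] : (forall i, i \in enum 'I_d -> x ≼ kap * (x - r i)) \/
    x ≼ kap ^+ (2 * d) * W.
  apply: all_or => i _; have [] := sle_split S (x - r i) (r i); rewrite subrK; first by left.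
  move=> h; right; apply: (sle_kap_wide S (m := 1)); first lia.
  rewrite expr1; apply: sle_trans S _ _ _ h _; apply: (sle_mul2l S).
  exact: sle_trans S _ _ _ (r_max i) AW.
have xf : x ^+ d ≼ kap ^+ d * f.[x].
  have -> : kap ^+ d * f.[x] = \prod_(i <- enum 'I_d) (kap * (x - r i)).
    by rewrite big_enum fE big_split /= prodr_const card_ord.
  by rewrite -[X in x ^+ X](size_enum_ord d); apply: (const_sle_prod S).
have {}xf Z : x ≼ Z -> G ≼ Z -> x ^+ d ≼ kap ^+ (d + e) * Z ^+ e.
  move=> xZ GZ; rewrite exprD -mulrA; apply: sle_trans S _ _ _ xf _.
  apply: (sle_mul2l S); rewrite -gy.
  have yZ : y ≼ kap ^+ 0 * Z by rewrite mul1r; apply: sle_trans S _ _ _ (xmax _) xZ.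
  by have := sle_g yZ yZ GZ; rewrite mul1n -exprS prednK.
apply: (sle_kap_wide S (m := (d + e)%N)); first lia.
case: (sle_total S G x) => Gx.
  have [x0|x0] := eqVneq x 0; first by rewrite x0; apply: sle_ge0 S _.
  case: (sle_total S x 1) => x1.
    by apply: sle_trans S _ _ _ x1 _; apply: sle_trans S _ _ _ W1 _; apply: (sle_kapM S).
  apply: sle_trans S _ _ _ (sle_expr_self (n := d - e) _ x1) _; first lia.
  apply: (sle_trans S (y := kap ^+ (d + e))); last first.
    by rewrite -[X in X ≼ _]mulr1; apply: (sle_mul2l S).
  apply: (sle_cancel S (expf_neq0 e x0)); rewrite -exprD subnKC ?(ltnW ed) // mulrC.
  by apply: xf => //; apply: sle_refl S _.
have d0 : (0 < d)%N by lia.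
apply: (sle_root S d0); rewrite exprMn -exprM.
apply: (sle_kap_wide S (m := (d + e)%N)); first nia.
apply: sle_trans S _ _ _ (xf _ Gx (sle_refl S _)) _.
exact: (sle_mul2l S).
Qed.

End Paths.

(** The first factor adds both critical value estimates and the loss of [sle_g] at the exponent 2 d
    of [path_bound]; the factor d d pays for the powers taken when comparing A with G. *)
Definition root_exp d e := ((crit_exp d + crit_exp e + (2 * d).+1 * e) * (d * d))%N.

Section RootBound.
Variables (d e : nat) (k : closedFieldType) (ch0 : [pchar k] =i pred0).
Hypothesis (e0 : (0 < e)%N) (ed : (e < d)%N).
Variables (le : k -> k -> Prop) (kap : k).
Hypothesis S : is_size d le kap.
Local Notation "x ≼ y" := (le x y) (at level 70, no associativity).

(* If the roots of f dominate ([G ^+ e ≼ A ^+ d]) use a critical point of f with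
   large value; otherwise use an x with f(x) = g(b), b a critical point of g with
   large value. *)
Lemma root_bound (r : 'I_d -> k) (s : 'I_e -> k) i0 i1 j0 j1
    (f := \prod_i ('X - (r i)%:P)) (g := \prod_j ('X - (s j)%:P)) :
  r i0 = 0 -> s j0 = 0 -> (forall i, r i ≼ r i1) -> (forall j, s j ≼ s j1) ->
  PCC f g -> r i1 ≼ kap ^+ root_exp d e /\ s j1 ≼ kap ^+ root_exp d e.
Proof.
move=> r0 s0 r_max s_max pcc; set A := r i1; set G := s j1.
set N := root_exp d e; have d0 : (0 < d)%N by lia.
pose T1 := (crit_exp d + crit_exp e + (2 * d).+1 * e)%N.
have NE n : (n <= d * d)%N -> (T1 * n <= N)%N by move=> h; rewrite leq_mul2l h orbT.
have kapX m : (m <= N)%N -> kap ^+ m ≼ kap ^+ N.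
  move=> mN; rewrite -[X in _ ≼ X]mulr1; apply: (sle_kap_wide S mN).
  by rewrite mulr1; apply: sle_refl S _.
have le1 x : x ≼ 1 -> x ≼ kap ^+ N.
  by move=> x1; apply: sle_trans S _ _ _ x1 (sle_kapX S _).
have path1 P : is_path f g P -> g.[P 1] = f.[P 0] by move=> /(_ 0).
case: (sle_total S (G ^+ e) (A ^+ d)) => GA.
  case: (sle_total S A 1) => A1.
    split; apply: le1 => //; apply: (sle_root S e0); rewrite expr1n.
    by apply: sle_trans S _ _ _ GA _; rewrite -(expr1n _ d); apply: (sle_exp S).
  have A0 : A != 0 by apply: (sle_eq0 S A1); apply: oner_neq0.
  have [c f'c Af] := crit_value_large ch0 S r0 A0 r_max.
  have [P [pathP [P0 prepP]]] := pcc c (or_introl f'c).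
  have Pb := path_bound e0 ed S s0 r_max s_max pathP prepP A1 (sle_refl S _) GA.
  have gP : g.[P 1%N] = f.[c] by rewrite -P0; apply: path1.
  have Abound : A ≼ kap ^+ (T1 * e).
    have AT1 Z : A ≼ Z -> G ≼ Z -> A ^+ d ≼ kap ^+ T1 * (A * Z ^+ e.-1).
      move=> AZ GZ; apply: (sle_kap_wide S (m := (crit_exp d + (2 * d).+1 * e)%N)).
        by rewrite /T1; lia.
      apply: (sle_kap_trans S Af); rewrite -gP.
      apply: (sle_g e0 S s0 s_max (Pb _) _ GZ).
      by apply: sle_trans S _ _ _ (Pb _) _; apply: (sle_mul2l S).
    apply: sle_trans S _ _ _ (sle_expr_self S (n := d - e) _ A1) _; first lia.
    case: (sle_total S G A) => h.
      apply: (sle_cancel S (expf_neq0 e A0)); rewrite -exprD subnKC ?(ltnW ed) // mulrC.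
      have := AT1 A (sle_refl S _) h; rewrite -exprS prednK //.
      by apply: (sle_kap_wide S); rewrite leq_pmulr.
    (* Here G dominates A. The e-th power of [AT1], with G^e replaced by A^d, compares A^(d e) with
       A^(e + d (e-1)); the exponents differ by d - e. *)
    have := sle_kap_exp S e (AT1 G h (sle_refl S _)).
    have GAe : (A * G ^+ e.-1) ^+ e ≼ A ^+ e * (A ^+ d) ^+ e.-1.
      rewrite exprMn -[(G ^+ _) ^+ _]exprM [(e.-1 * e)%N]mulnC exprM; apply: (sle_mul2l S).
      exact: (sle_exp S _ GA).
    move=> /(sle_trans S)/(_ (sle_mul2l S _ GAe)) H.
    apply: (sle_cancel S (expf_neq0 (e + d * e.-1) A0)).
    have E : ((e + d * e.-1 + (d - e)) = d * e)%N.
      by case: (e) e0 ed => // e' _ e'd; rewrite /= mulnS; lia.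
    by rewrite -exprD E [X in _ ≼ X]mulrC exprM exprD [A ^+ (d * _)]exprM.
  split.
    by apply: sle_trans S _ _ _ Abound _; apply/kapX/NE; nia.
  apply: (sle_root S e0); apply: sle_trans S _ _ _ GA _.
  apply: sle_trans S _ _ _ (sle_exp S d Abound) _; rewrite -!exprM.
  rewrite -[X in _ ≼ X]mulr1; apply: (sle_kap_wide S (m := (T1 * e * d)%N)).
    by rewrite -mulnA; apply: leq_trans (NE _ _) (leq_pmulr _ _); rewrite ?leq_mul // ltnW.
  by rewrite mulr1; apply: sle_refl S _.
case: (sle_total S G 1) => G1.
  split; apply: le1 => //; apply: (sle_root S d0); rewrite expr1n.
  by apply: sle_trans S _ _ _ GA _; rewrite -(expr1n _ e); apply: (sle_exp S).
have G0 : G != 0 by apply: (sle_eq0 S G1); apply: oner_neq0.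
have [b g'b Gg] := crit_value_large ch0 (is_size_leq (ltnW ed) S) s0 G0 s_max.
have sf : size f = d.+1 by apply: size_prod_XsubC_ord.
have [|x] := closed_root (p := f - (g.[b])%:P).
  by rewrite size_polyDl ?sf // size_polyN; apply: leq_ltn_trans (size_polyC_leq1 _) _.
rewrite !hornerE => /eqP; rewrite subr_eq0 => /eqP fx.
have [|P [pathP [P0 prepP]]] := pcc x; first by right; exists b.
have gP : g.[P 1%N] = g.[b] by rewrite -fx -P0; apply: path1.
(* This W meets the hypothesis of [path_bound] on G with equality; it still dominates A and 1, and
   it is at most G. *)
have [W WE] : exists W, W ^+ d = G ^+ e.
  have [|W] := closed_root (p := 'X^d - (G ^+ e)%:P); first by rewrite size_XnsubC.
  by rewrite !hornerE => /eqP; rewrite subr_eq0 => /eqP WE; exists W.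
have W1 : 1 ≼ W by apply: (sle_root S d0); rewrite expr1n WE; apply: (sle_expr_1 S).
have AW : A ≼ W by apply: (sle_root S d0); rewrite WE.
have GW : G ^+ e ≼ W ^+ d by rewrite WE; apply: sle_refl S _.
have WG : W ≼ G.
  apply: (sle_root S d0); rewrite WE -(subnK (ltnW ed)) exprD -[X in X ≼ _]mul1r.
  by apply: (sle_mul2r S); apply: (sle_expr_1 S).
have Pb := path_bound e0 ed S s0 r_max s_max pathP prepP W1 AW GW.
(* Up to [kap], G^e is at most g(b) = g(P 1), which is at most W G^(e-1). The d-th power of the
   result compares G^d with W^d = G^e and bounds G. *)
have G_W : G ≼ kap ^+ T1 * W.
  apply: (sle_cancel S (expf_neq0 e.-1 G0)); rewrite -exprSr prednK //.
  apply: (sle_trans S (y := kap ^+ T1 * (W * G ^+ e.-1))); last first.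
    by rewrite mulrA mulrC; apply: sle_refl S _.
  apply: (sle_kap_wide S (m := (crit_exp e + (2 * d).+1 * e)%N)); first by rewrite /T1; lia.
  apply: (sle_kap_trans S Gg); rewrite -gP.
  apply: (sle_g e0 S s0 s_max (Pb _) _ (sle_refl S _)).
  by apply: sle_trans S _ _ _ (Pb _) _; apply: (sle_mul2l S).
have Gbound : G ≼ kap ^+ (T1 * d).
  apply: sle_trans S _ _ _ (sle_expr_self S (n := d - e) _ G1) _; first lia.
  apply: (sle_cancel S (expf_neq0 e G0)); rewrite -exprD subnKC ?(ltnW ed) // mulrC.
  by rewrite -WE; apply: (sle_kap_exp S).
split; last by apply: sle_trans S _ _ _ Gbound _; apply/kapX/NE; nia.
apply: (sle_root S d0); apply: sle_trans S _ _ _ GA _.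
apply: sle_trans S _ _ _ (sle_exp S e Gbound) _; rewrite -!exprM.
rewrite -[X in _ ≼ X]mulr1; apply: (sle_kap_wide S (m := (T1 * d * e)%N)).
  by rewrite -mulnA; apply: leq_trans (NE _ _) (leq_pmulr _ _); rewrite ?leq_mul // ltnW.
by rewrite mulr1; apply: sle_refl S _.
Qed.

Lemma coef_prod_bound (s : seq k) W i :
  1 ≼ W -> (forall x, x \in s -> x ≼ W) ->
  (\prod_(x <- s) ('X - x%:P))`_i ≼ kap ^+ size s * W ^+ size s.
Proof.
move=> W1; elim: s i => [|a s IH] i sW.
  rewrite big_nil coef1 mul1r expr0.
  by case: (i == 0%N); [apply: sle_refl S _ | apply: sle_ge0 S _].
have {}IH j : (\prod_(x <- s) ('X - x%:P))`_j ≼ kap ^+ size s * W ^+ size s.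
  by apply: IH => x xs; apply: sW; rewrite inE xs orbT.
rewrite big_cons mulrBl coefB coefXM coefCM /= !exprS -mulrA; apply: (sle_sub S).
  case: (i == 0%N); first exact: sle_ge0 S _.
  apply: sle_trans S _ _ _ (IH _) _; apply: (sle_mul2l S).
  by rewrite -[X in X ≼ _]mul1r; apply: (sle_mul2r S).
rewrite [X in _ ≼ X]mulrCA; apply: (sle_mul S); last exact: IH.
by apply: sW; rewrite mem_head.
Qed.

Definition coef_exp := (d + root_exp d e * d)%N.

Lemma coef_bound (a b : nat -> k) : PCC (normpoly d a) (normpoly e b) ->
  (forall i, (1 <= i < d)%N -> a i ≼ kap ^+ coef_exp) /\
  (forall j, (1 <= j < e)%N -> b j ≼ kap ^+ coef_exp).
Proof.
have d0 : (0 < d)%N by lia.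
have [r fE [i0 r0]] := normpoly_roots a d0.
have [s gE [j0 s0]] := normpoly_roots b e0.
have [|i1 _ r_max] := sle_max S r (s := enum 'I_d); first by rewrite -size_eq0 size_enum_ord; lia.
have {}r_max i : r i ≼ r i1 by apply: r_max; rewrite mem_enum.
have [|j1 _ s_max] := sle_max S s (s := enum 'I_e); first by rewrite -size_eq0 size_enum_ord; lia.
have {}s_max j : s j ≼ s j1 by apply: s_max; rewrite mem_enum.
move=> pcc; have := pcc; rewrite fE gE => /(root_bound r0 s0 r_max s_max)[rb sb].
have coefs n (t : 'I_n -> k) i : (n <= d)%N -> (forall j, t j ≼ kap ^+ root_exp d e) ->
    (\prod_j ('X - (t j)%:P))`_i ≼ kap ^+ coef_exp.
  move=> nd tb; rewrite -big_enum /= -(big_map t predT (fun x => 'X - x%:P)).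
  apply: sle_trans S _ _ _ (coef_prod_bound i (sle_kapX S (root_exp d e)) _) _.
    by move=> _ /mapP[j _ ->].
  rewrite size_map size_enum_ord -exprM -exprD -[X in _ ≼ X]mulr1.
  apply: (sle_kap_wide S (m := (n + root_exp d e * n)%N)); last first.
    by rewrite mulr1; apply: sle_refl S _.
  by rewrite /coef_exp leq_add // leq_mul2l nd orbT.
split=> i id.
  rewrite -(coef_normpoly a id) fE; apply: coefs => // j.
  exact: sle_trans S _ _ _ (r_max j) rb.
rewrite -(coef_normpoly b id) gE; apply: coefs => [|j]; first exact: ltnW.
exact: sle_trans S _ _ _ (s_max j) sb.
Qed.

End RootBound.

(** * Valuation rings and integrality *)

Definition subring (k : fieldType) (A : set k) : Prop :=
  [/\ A 1, forall u v, A u -> A v -> A (u - v) & forall u v, A u -> A v -> A (u * v)].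

Definition adjoin (k : fieldType) (A : set k) (y : k) : set k :=
  [set u | exists2 p : {poly k}, (forall i, A p`_i) & u = p.[y]]%classic.

Section Subring.
Variables (k : fieldType) (A : set k).
Hypothesis Asub : subring A.

Lemma subring1 : A 1. Proof. by case: Asub. Qed.
Lemma subringB u v : A u -> A v -> A (u - v). Proof. by case: Asub => _ h _; apply: h. Qed.
Lemma subringM u v : A u -> A v -> A (u * v). Proof. by case: Asub => _ _ h; apply: h. Qed.
Lemma subring0 : A 0. Proof. by rewrite -(subrr 1); apply: subringB subring1 subring1. Qed.
Lemma subringN u : A u -> A (- u).
Proof. by move=> Au; rewrite -sub0r; apply: subringB subring0 Au. Qed.
Lemma subringD u v : A u -> A v -> A (u + v).
Proof. by move=> Au Av; rewrite -[v]opprK; apply: subringB Au (subringN Av). Qed.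
Lemma subringX u n : A u -> A (u ^+ n).
Proof.
move=> Au; elim: n => [|n IH]; first exact: subring1.
by rewrite exprS; apply: subringM.
Qed.
Lemma subring_sum (I : Type) (s : seq I) (P : pred I) (F : I -> k) :
  (forall i, P i -> A (F i)) -> A (\sum_(i <- s | P i) F i).
Proof. by move=> AF; apply: big_ind => //; [exact: subring0 | exact: subringD]. Qed.
Lemma subring_nat n : A n%:R.
Proof. by elim: n => [|n IH]; [exact: subring0 | rewrite mulrS; apply: subringD subring1 IH]. Qed.

Lemma adjoin_subring y : subring (adjoin A y).
Proof.
split=> [|_ _ [p Ap ->] [q Aq ->]|_ _ [p Ap ->] [q Aq ->]].
- exists 1; last by rewrite hornerC.
  by move=> i; rewrite coef1; case: (i == 0%N); [apply: subring1 | apply: subring0].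
- by exists (p - q); [move=> i; rewrite coefB; apply: subringB | rewrite !hornerE].
- exists (p * q); last by rewrite hornerM.
  by move=> i; rewrite coefM; apply: subring_sum => j _; apply: subringM.
Qed.

Lemma adjoin_sub y u : A u -> adjoin A y u.
Proof.
move=> Au; exists u%:P; last by rewrite hornerC.
by move=> i; rewrite coefC; case: (i == 0%N) => //; apply: subring0.
Qed.

Lemma adjoin_gen y : adjoin A y y.
Proof.
exists 'X; last by rewrite hornerX.
by move=> i; rewrite coefX; case: (i == 1%N); [apply: subring1 | apply: subring0].
Qed.
End Subring.

(* A subring maximal among those containing x^-1 but not x is a valuation
   ring. *)
Section MaximalSubring.
Variables (k : fieldType) (A : set k) (x : k).
Hypothesis Asub : subring A.
Hypothesis x0 : x != 0.
Hypothesis Ax' : A x^-1.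
Hypothesis Ax : ~ A x.
Hypothesis Amax : forall y, ~ A y -> adjoin A y x.
Local Notation t := x^-1.

(* [t] lies in the Jacobson radical of [A]. *)
Lemma one_sub_unit q : A q -> 1 - t * q != 0 /\ A (1 - t * q)^-1.
Proof.
move=> Aq; set u := 1 - t * q; have Au : A u.
  by apply: (subringB Asub); [apply: subring1 Asub | apply: (subringM Asub)].
have not1 c : A c -> t * c != 1.
  move=> Ac; apply/eqP => /(congr1 ( *%R x)); rewrite mulVKf // mulr1 => cx.
  by apply: Ax; rewrite -cx.
have u0 : u != 0 by rewrite subr_eq0 eq_sym; apply: not1.
split=> //; apply: contrapT => /Amax[p Ap xE].
(* If u^-1 is not in [A], then x = p(u^-1) puts u^n x in [A], so u^n lies in t A. But u is 1 modulo
   t A, hence so is u^n, which forces 1 into t A. *)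
have [c Ac uc] : exists2 c, A c & u ^+ (size p) = t * c.
  exists (u ^+ size p * x); last by rewrite mulrCA mulVf // mulr1.
  rewrite xE horner_coef mulr_sumr; apply: (subring_sum Asub) => i _.
  rewrite mulrCA; apply: (subringM Asub) => //.
  by rewrite exprVn -expfB_cond ?(negPf u0) ?(ltnW (ltn_ord i)) //; apply: (subringX Asub).
have [c' Ac' uc'] : exists2 c', A c' & u ^+ (size p) = 1 - t * c'.
  elim: (size p) => [|n [c' Ac' E]].
    by exists 0; [apply: subring0 Asub | rewrite mulr0 subr0].
  exists (c' + q - t * c' * q); last by rewrite exprS E /u; ring.
  apply: (subringB Asub); first by apply: (subringD Asub).
  by do 2!apply: (subringM Asub) => //.
have /negP[] := not1 _ (subringD Asub Ac Ac').
by rewrite mulrDr -uc uc' subrK.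
Qed.

(* Descent on the degrees: since 1 - t q_0 is a unit, the relation x = q(y^-1)
   rewrites the top power of y in p in terms of lower ones. *)
Lemma no_two_sided (y : k) (p q : {poly k}) : y != 0 ->
  (forall i, A p`_i) -> (forall i, A q`_i) -> x = p.[y] -> x = q.[y^-1] -> False.
Proof.
move: {2}(size p + size q)%N (leqnn (size p + size q)) => N.
elim: N y p q => [|N IH] y p q pqN y0 Ap Aq xp xq.
  have /eqP p0 : p == 0 by rewrite -size_poly_eq0; move: pqN; case: (size p).
  by move/eqP: x0; apply; rewrite xp p0 horner0.
wlog qp : y p q pqN y0 Ap Aq xp xq / (size q <= size p)%N => [H|].
  have [qp|/ltnW pq] := leqP (size q) (size p); first exact: (H y p q).
  by apply: (H y^-1 q p) => //; rewrite ?invrK ?invr_eq0 // addnC.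
have [u0 Au] := one_sub_unit (Aq 0%N).
set u := 1 - t * q`_0 in u0 Au.
case sp : (size p) => [|n].
  by move/eqP: sp; rewrite size_poly_eq0 => /eqP p0; move/eqP: x0; apply; rewrite xp p0 horner0.
(* From 1 = t q(y^-1), u is t times the part of q(y^-1) without constant term. Inserting u^-1 u
   turns p_n y^n into the sum of c_j y^(n-j) over j >= 1; the subtraction n - j does not truncate
   because q is no longer than p. *)
pose c j := p`_n * (t * (u^-1 * q`_j)).
have Ac j : A (c j) by do 3!apply: (subringM Asub) => //.
pose p' := \poly_(i < n) p`_i + \sum_(1 <= j < size q) c j *: 'X^(n - j).
have jn_le j : (j < size q)%N -> (j <= n)%N.
  by move=> jq; rewrite -ltnS -sp; apply: leq_trans jq qp.
have sp' : (size p' <= n)%N.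
  apply: leq_trans (size_polyD _ _) _; rewrite geq_max size_poly /=.
  rewrite big_nat_cond; apply: (big_ind (fun r : {poly k} => (size r <= n)%N)).
  - by rewrite size_poly0.
  - by move=> r s rn sn; apply: leq_trans (size_polyD _ _) _; rewrite geq_max rn.
  - move=> j /andP[/andP[j1 jq] _]; apply: leq_trans (size_scale_leq _ _) _.
    by have jn := jn_le j jq; rewrite size_polyXn; clear -j1 jn; lia.
apply: (IH y p' q) => //.
- by rewrite -ltnS; apply: leq_trans pqN; rewrite sp addSn ltnS leq_add2r.
- move=> i; rewrite coefD coef_poly coef_sum; apply: (subringD Asub).
    by case: ifP => _ //; apply: subring0 Asub.
  apply: (subring_sum Asub) => j _; rewrite coefZ coefXn; apply: (subringM Asub) => //.
  exact: (subring_nat Asub).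
rewrite xp horner_coef sp big_ord_recr /= /p' hornerD horner_poly; congr (_ + _).
rewrite horner_sum.
have q1 : 1 = t * q`_0 + t * \sum_(1 <= j < size q) q`_j * y^-1 ^+ j.
  rewrite -mulrDr -[1](mulVf x0) {2}xq horner_coef; congr (_ * _).
  rewrite -(big_mkord xpredT (fun j => q`_j * y^-1 ^+ j)).
  case sq : (size q) => [|m]; last by rewrite big_ltn // expr0 mulr1.
  move/eqP: sq; rewrite size_poly_eq0 => /eqP q0.
  by move: x0; rewrite xq q0 horner0 eqxx.
have ue : u = t * \sum_(1 <= j < size q) q`_j * y^-1 ^+ j.
  by rewrite /u {1}q1; ring.
have -> : p`_n * y ^+ n = p`_n * y ^+ n * (u^-1 * u) by rewrite mulVf ?mulr1.
rewrite {2}ue mulrA [_ * t]mulrC -mulrA !mulr_sumr !big_nat; apply: eq_bigr => j /andP[j1 jq].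
have yn : y ^+ n = y ^+ (n - j) * y ^+ j by rewrite -exprD subnK ?jn_le.
rewrite hornerZ hornerXn /c yn exprVn.
have yj : y ^+ j != 0 by rewrite expf_neq0.
by field; rewrite ?x0 ?yj ?u0.
Qed.

Lemma maximal_valuation y : A y \/ A y^-1.
Proof.
have [->|y0] := eqVneq y 0; first by left; apply: subring0 Asub.
apply: contrapT => /not_orP[/Amax[p Ap xp] /Amax[q Aq xq]].
exact: (no_two_sided y0 Ap Aq xp xq).
Qed.
End MaximalSubring.

Section Integrality.
Variable k : fieldType.

Definition integral_over_Z (x : k) :=
  exists2 p : {poly int}, p \is monic & (map_poly intr p).[x] = 0.

(** Multiplying x = p(x^-1) by x^n, with n the size of p, gives a monic equation of degree n + 1. *)
Lemma integral_of_inv_poly (x : k) (p : {poly int}) : x != 0 ->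
  x = (map_poly intr p).[x^-1] -> integral_over_Z x.
Proof.
move=> x0 xE; pose n := size p.
pose q : {poly int} := \sum_(i < n) p`_i *: 'X^(n - i).
have sq : (size q <= n.+1)%N.
  apply: (big_ind (fun r : {poly int} => (size r <= n.+1)%N)).
  - by rewrite size_poly0.
  - by move=> r s rn sn; apply: leq_trans (size_polyD _ _) _; rewrite geq_max rn.
  - move=> i _; apply: leq_trans (size_scale_leq _ _) _.
    by rewrite size_polyXn ltnS leq_subr.
pose r : {poly int} := 'X^(n.+1) - q.
exists r; first by apply/monicP; rewrite lead_coefDl ?lead_coefXn // size_polyN size_polyXn ltnS.
rewrite /r rmorphB /= map_polyXn hornerD hornerN hornerXn rmorph_sum /= horner_sum.
apply/eqP; rewrite subr_eq0 exprSr {2}xE horner_poly mulr_sumr; apply/eqP; apply: eq_bigr => i _.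
rewrite map_polyZ map_polyXn hornerZ hornerXn mulrCA; congr (_ * _).
have xn : x ^+ n = x ^+ (n - i) * x ^+ i by rewrite -exprD subnK // ltnW.
by rewrite xn exprVn mulfK // expf_neq0.
Qed.

(** Z[x^-1] omits x because x is not integral; Zorn's lemma supplies a maximal subring containing
    x^-1 and omitting x. *)
Lemma valuation_of_nonintegral (x : k) : ~ integral_over_Z x ->
  exists O : set k, [/\ subring O, forall y, O y \/ O y^-1 & ~ O x].
Proof.
move=> xint; have x0 : x != 0.
  apply: contra_notN xint => /eqP ->; exists 'X; first exact: monicX.
  by rewrite map_polyX hornerX.
pose good (A : set k) := [/\ subring A, A x^-1 & ~ A x].
pose PA (A : set k) := A = set0 \/ good A.
have [|A [PAA Amax]] := @Zorn_bigcup k PA.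
  move=> F FP tot.
  have [[X [FX X0]]|allz] := EM (exists X, F X /\ X <> set0); last first.
    left; rewrite -subset0 => u [X FX Xu].
    by apply: allz; exists X; split=> // X0; rewrite X0 in Xu.
  have goodF Y u : F Y -> Y u -> good Y.
    by move=> FY Yu; have [Y0|//] := FP _ FY; rewrite Y0 in Yu.
  have gX : good X by have [|] := FP _ FX.
  have join u v : (\bigcup_(Y in F) Y)%classic u -> (\bigcup_(Y in F) Y)%classic v ->
      exists Y, [/\ F Y, Y u & Y v].
    move=> [Y FY Yu] [Z FZ Zv]; have [YZ|ZY] := tot _ _ FY FZ.
      by exists Z; split=> //; apply: YZ.
    by exists Y; split=> //; apply: ZY.
  right; split; first split.
  - by exists X => //; have [[]] := gX.
  - move=> u v /join h /h[Y [FY Yu Yv]]; exists Y => //.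
    by have [Ysub _ _] := goodF _ _ FY Yu; apply: subringB.
  - move=> u v /join h /h[Y [FY Yu Yv]]; exists Y => //.
    by have [Ysub _ _] := goodF _ _ FY Yu; apply: subringM.
  - by exists X => //; have [] := gX.
  - by move=> [Y FY Yx]; have [_ _] := goodF _ _ FY Yx.
pose Z0 : set k := [set u | exists p : {poly int}, u = (map_poly intr p).[x^-1]]%classic.
have gZ0 : good Z0.
  split; first split.
  - by exists 1; rewrite rmorph1 hornerC.
  - by move=> _ _ [p ->] [q ->]; exists (p - q); rewrite rmorphB /= !hornerE.
  - by move=> _ _ [p ->] [q ->]; exists (p * q); rewrite rmorphM /= hornerM.
  - by exists 'X; rewrite map_polyX hornerX.
  - by move=> [p /(integral_of_inv_poly x0)].
have {PAA} [Asub Ax' Ax] : good A.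
  case: PAA => // A0; case: (Amax Z0); last by right.
  rewrite A0; split; first exact: sub0set.
  by move=> /(_ x^-1) h; apply: h; have [] := gZ0.
exists A; split=> //.
apply: (maximal_valuation Asub x0 Ax' Ax) => y Ay.
apply: contrapT => Bx; case: (Amax (adjoin A y)).
  split; first exact: adjoin_sub.
  by move=> /(_ y) h; apply: Ay; apply: h; apply: adjoin_gen.
by right; split=> //; [apply: adjoin_subring | apply: adjoin_sub].
Qed.

(** Every n from 1 to d divides the factorial M, so M / n lies in [O] whatever the residue
    characteristic. The valuation property gives totality. *)
Lemma valuation_size d (O : set k) : [pchar k] =i pred0 ->
  subring O -> (forall y, O y \/ O y^-1) ->
  is_size d (fun a b => exists2 c, O c & a = c * b) ((d.+1)`!%:R)^-1.
Proof.
move=> ch0 Osub Oval; set M := (d.+1)`!.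
have M0 : M%:R != 0 :> k by apply: natr_neq0_pchar0 => //; apply: fact_gt0.
split.
- move=> y x z [c Oc ->] [c' Oc' ->]; exists (c * c'); last by rewrite mulrA.
  exact: (subringM Osub).
- move=> x y; have [->|y0] := eqVneq y 0.
    by right; exists 0; [apply: (subring0 Osub) | rewrite mul0r].
  have [->|x0] := eqVneq x 0.
    by left; exists 0; [apply: (subring0 Osub) | rewrite mul0r].
  have [h|h] := Oval (x / y); [left|right].
    by exists (x / y); rewrite // mulfVK.
  by exists (x / y)^-1; rewrite // invf_div mulfVK.
- move=> x y u v [c Oc ->] [c' Oc' ->]; exists (c * c'); last by rewrite mulrACA.
  exact: (subringM Osub).
- by move=> x [c _ ->]; rewrite mulr0.
- by move=> x; exists 0; [apply: (subring0 Osub) | rewrite mul0r].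
- by exists M%:R; [apply: (subring_nat Osub) | rewrite mulfV].
- move=> _ _ z [c Oc ->] [c' Oc' ->]; exists ((c + c') * M%:R).
    by apply: (subringM Osub); [apply: (subringD Osub) | apply: (subring_nat Osub)].
  by rewrite mulrA mulfK // mulrDl.
- move=> n /andP[n0 nd]; have nM : (n %| M)%N by rewrite dvdn_fact // n0 leqW.
  exists (M %/ n)%:R; first exact: (subring_nat Osub).
  by rewrite mulrCA -natrM divnK // mulVf.
Qed.
End Integrality.

(** A nonintegral element is missed by some valuation ring, whereas [coef_bound] puts the scaled
    coefficients into all of them. *)
Lemma PCC_integral d e (k : closedFieldType) (a b : nat -> k) :
  (0 < e)%N -> (e < d)%N -> [pchar k] =i pred0 -> PCC (normpoly d a) (normpoly e b) ->
  (forall i, (1 <= i < d)%N -> integral_over_Z ((d.+1)`!%:R ^+ coef_exp d e * a i)) /\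
  (forall j, (1 <= j < e)%N -> integral_over_Z ((d.+1)`!%:R ^+ coef_exp d e * b j)).
Proof.
move=> e0 ed ch0 pcc; set M := _%:R ^+ _.
have M0 : M != 0 by rewrite expf_neq0 // natr_neq0_pchar0 // fact_gt0.
have bound O : subring O -> (forall y, O y \/ O y^-1) -> 
  (forall i, (1 <= i < d)%N -> O (M * a i)) /\ (forall j, (1 <= j < e)%N -> O (M * b j)).
  move=> Osub Oval; have S := valuation_size d ch0 Osub Oval.
  have [ab bb] := coef_bound ch0 e0 ed S pcc.
  by split=> i id; [have [c Oc ->] := ab i id | have [c Oc ->] := bb i id];
    rewrite exprVn mulrCA -/M mulfV ?mulr1.
by split=> i id; apply: contrapT => /valuation_of_nonintegral[O [Osub Oval]]; apply;
  have [Oa Ob] := bound O Osub Oval; [apply: Oa | apply: Ob].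
Qed.

(** * Transport to the algebraic numbers *)

Lemma exists_minimal_poly (K L : fieldType) (phi : {rmorphism K -> L}) z :
  algebraicOver phi z ->
  exists2 h, monic_irreducible_poly h & root (map_poly phi h) z.
Proof.
move=> [p0 p00 p0z].
pose Pn n := `[< exists2 p : {poly K}, p != 0 /\ size p = n & root (map_poly phi p) z >].
have [|n /asboolP[p [pn0 sp] pz] nmin] := @ex_minnP Pn.
  by exists (size p0); apply/asboolP; exists p0.
have {}nmin q : q != 0 -> root (map_poly phi q) z -> (n <= size q)%N.
  by move=> q0 qz; apply: nmin; apply/asboolP; exists q.
have irr : irreducible_poly p.
  split=> [|q sq qp].
    rewrite ltnNge; apply/negP => /size1_polyC pE; move: pz pn0.
    by rewrite pE map_polyC /= rootC fmorph_eq0 => /eqP ->; rewrite eqxx.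
  have /dvdpP[e pE] := qp.
  have e0 : e != 0 by apply: contra_neq pn0 => e0; rewrite pE e0 mul0r.
  have q0 : q != 0 by apply: contra_neq pn0 => q0; rewrite pE q0 mulr0.
  have : root (map_poly phi e) z || root (map_poly phi q) z.
    by rewrite -rootM -rmorphM -pE.
  case/orP => [/(nmin _ e0)|/(nmin _ q0)] le_n.
    have := size_mul e0 q0; rewrite -pE sp => nE.
    have q1 : (0 < size q)%N by rewrite lt0n size_poly_eq0.
    move: sq q1 nE le_n; set a := size e; set b := size q => /eqP sq q1 nE le_n.
    by exfalso; clear -sq q1 nE le_n; lia.
  by rewrite -dvdp_size_eqp // sp eqn_leq le_n -sp dvdp_leq.
have lc : lead_coef p != 0 by rewrite lead_coef_eq0.
exists ((lead_coef p)^-1 *: p); last by rewrite map_polyZ rootZ // fmorph_eq0 invr_eq0.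
split; last by rewrite monicE lead_coefZ mulVf.
split=> [|q sq]; first by rewrite size_scale ?invr_eq0 //; case: irr.
rewrite dvdpZr ?invr_eq0 // => /(irr.2 _ sq) qp.
by apply: eqp_trans qp _; rewrite eqp_sym eqp_scale // invr_eq0.
Qed.

Section QuotientEmbedding.
Variables (K L : fieldType) (phi : {rmorphism K -> L}) (h : {poly K}) (z : L).
Hypothesis hI : monic_irreducible_poly h.
Hypothesis hz : root (map_poly phi h) z.

Let psi (p : {poly %/ h with hI}) : L := (map_poly phi ((p : {poly %/ h}) : {poly K})).[z].

Lemma eval_rmodp (p : {poly K}) :
  (map_poly phi (Pdiv.Ring.rmodp p (mk_monic h))).[z] = (map_poly phi p).[z].
Proof.
rewrite (mk_monicE hI) [p in RHS](Pdiv.RingMonic.rdivp_eq hI.2 p).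
by rewrite rmorphD rmorphM /= hornerD hornerM (rootP hz) mulr0 add0r.
Qed.

Lemma qfpoly_embedding : exists psi : {rmorphism {poly %/ h with hI} -> L},
  (forall c, psi (qpolyC h c) = phi c) /\ psi (qpolyX h) = z.
Proof.
have psiB : zmod_morphism psi.
  by move=> p q; rewrite /psi /= rmorphB /= hornerD hornerN.
have psiM : monoid_morphism psi.
  split=> [|p q]; first by rewrite /psi /= map_polyC /= rmorph1 hornerC.
  by rewrite /psi /= eval_rmodp rmorphM hornerM.
pose F := HB.pack_for {rmorphism {poly %/ h with hI} -> L} psi
  (GRing.isZmodMorphism.Build _ _ _ psiB) (GRing.isMonoidMorphism.Build _ _ _ psiM).
exists F; split=> [c|].
  by rewrite /F /= /psi /= map_polyC hornerC.
by rewrite /F /= /psi /= eval_rmodp map_polyX hornerX.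
Qed.
End QuotientEmbedding.

Section RatrChar0.
Variables (F : fieldType) (ch0 : [pchar F] =i pred0).

Lemma intr_neq0_pchar0 (z : int) : z != 0 -> z%:~R != 0 :> F.
Proof.
case: z => n n0; first by rewrite -[n%:~R]/(n%:R) natr_neq0_pchar0 // lt0n.
by rewrite NegzE mulrNz oppr_eq0; apply: natr_neq0_pchar0.
Qed.

(** [ratr] is computed from the reduced fraction; independence of the representative gives its
    additivity and multiplicativity in characteristic 0. *)
Lemma ratr_of_frac (x : rat) (n d : int) : d != 0 -> x * d%:~R = n%:~R ->
  ratr x = n%:~R / d%:~R :> F.
Proof.
move=> d0 xd; have dx0 := intr_neq0_pchar0 (denq_neq0 x).
have e : (numq x * d = n * denq x)%R.
  apply: (@intr_inj rat); rewrite !rmorphM /= -xd numqE; ring.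
rewrite /ratr; apply/eqP; rewrite eqr_div ?intr_neq0_pchar0 //.
by rewrite -!rmorphM /= e.
Qed.

Lemma ratr_rmorphism : exists phi : {rmorphism rat -> F}, phi =1 ratr.
Proof.
have key (x : rat) : x * (denq x)%:~R = (numq x)%:~R by rewrite numqE.
have nz (x : rat) := intr_neq0_pchar0 (denq_neq0 x).
have rB : zmod_morphism (@ratr F).
  move=> x y; rewrite (@ratr_of_frac (x - y) (numq x * denq y - numq y * denq x)
    (denq x * denq y)) ?mulf_neq0 ?denq_neq0 //.
    by rewrite /ratr !(rmorphB, rmorphM) /=; field; rewrite !nz.
  by rewrite !(rmorphB, rmorphM) /= -!key; ring.
have rM : monoid_morphism (@ratr F).
  split=> [|x y]; first by rewrite (@ratr_of_frac 1 1 1) ?divr1 ?mulr1.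
  rewrite (@ratr_of_frac (x * y) (numq x * numq y) (denq x * denq y)) ?mulf_neq0 ?denq_neq0 //.
    by rewrite /ratr !rmorphM /=; field; rewrite !nz.
  by rewrite !rmorphM /= -!key; ring.
by exists (HB.pack_for {rmorphism rat -> F} (@ratr F)
  (GRing.isZmodMorphism.Build _ _ _ rB) (GRing.isMonoidMorphism.Build _ _ _ rM)).
Qed.
End RatrChar0.

Lemma pchar0_rmorph (K L : fieldType) (phi : {rmorphism K -> L}) :
  [pchar L] =i pred0 -> [pchar K] =i pred0.
Proof. by move=> ch0 p; rewrite -(fmorph_pchar phi) ch0. Qed.

Section CommonField.
Variables (k L : closedFieldType) (ch0 : [pchar k] =i pred0).

(* Q(x) embeds in both fields; the elements of [zs] are adjoined one at a time. *)
Lemma common_field (q : {poly rat}) (x : k) (r : L) (zs : seq k) :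
  [pchar L] =i pred0 -> irreducible_poly q ->
  root (map_poly ratr q) x -> root (map_poly ratr q) r ->
  (forall z, z \in zs -> algebraic z) ->
  exists (K : fieldType) (i : {rmorphism K -> k}) (j : {rmorphism K -> L}),
    (exists2 w, i w = x & j w = r) /\ forall z, z \in zs -> exists w, i w = z.
Proof.
move=> chL0 irr qx qr; elim: zs => [|z zs IH] algz.
  have [phi phiE] := ratr_rmorphism ch0; have [phi' phiE'] := ratr_rmorphism chL0.
  have lc : lead_coef q != 0 by rewrite lead_coef_eq0 irredp_neq0.
  pose h := (lead_coef q)^-1 *: q.
  have hI : monic_irreducible_poly h.
    split; last by rewrite monicE lead_coefZ mulVf.
    split=> [|p sp]; first by rewrite size_scale ?invr_eq0 //; case: irr.
    rewrite dvdpZr ?invr_eq0 // => /(irr.2 _ sp) qp.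
    by apply: eqp_trans qp _; rewrite eqp_sym eqp_scale // invr_eq0.
  have hx : root (map_poly phi h) x.
    by rewrite map_polyZ rootZ ?fmorph_eq0 ?invr_eq0 // (eq_map_poly phiE).
  have hr : root (map_poly phi' h) r.
    by rewrite map_polyZ rootZ ?fmorph_eq0 ?invr_eq0 // (eq_map_poly phiE').
  have [i [_ iX]] := qfpoly_embedding hI hx.
  have [j [_ jX]] := qfpoly_embedding hI hr.
  by exists {poly %/ h with hI}, i, j; split=> //; exists (qpolyX h).
have [|K [i [j [[w iw jw] Kzs]]]] := IH.
  by move=> u uz; apply: algz; rewrite inE uz orbT.
have algK : algebraicOver i z.
  have [p [p0 pz]] := algz z (mem_head _ _).
  have [phi phiE] := ratr_rmorphism (pchar0_rmorph i ch0).
  exists (map_poly phi p); first by rewrite map_poly_eq0.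
  rewrite -map_poly_comp; congr (root _ _): pz; apply: eq_map_poly => c /=.
  by rewrite [RHS](fmorph_eq_rat (i \o phi)).
have [h hI hz] := exists_minimal_poly algK.
(* Any root in [L] of the transported minimal polynomial of z extends [j]. *)
have [v hv] : exists v, root (map_poly j h) v.
  have [|v hv] := closed_root (p := map_poly j h); last by exists v; apply/rootP.
  by rewrite size_map_poly; case: (hI.1).
have [i' [i'C i'X]] := qfpoly_embedding hI hz.
have [j' [j'C _]] := qfpoly_embedding hI hv.
exists {poly %/ h with hI}, i', j'; split; first by exists (qpolyC h w); rewrite ?i'C ?j'C.
move=> u; rewrite inE => /orP[/eqP ->|/Kzs[c <-]]; first by exists (qpolyX h).
by exists (qpolyC h c).
Qed.
End CommonField.

Lemma map_normpoly (K L : fieldType) (phi : {rmorphism K -> L}) d (a : nat -> K) b :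
  (forall i, (1 <= i < d)%N -> phi (a i) = b i) ->
  map_poly phi (normpoly d a) = normpoly d b.
Proof.
move=> ab; rewrite /normpoly rmorphD /= map_polyXn rmorph_sum; congr (_ + _).
by apply: eq_big_nat => i /ab <-; rewrite /= map_polyZ map_polyXn.
Qed.

(** All roots of p in k come from K, so p already splits over K, and its roots in L are images of
    the same elements. *)
Lemma roots_lift (K : fieldType) (k L : closedFieldType) (i : {rmorphism K -> k})
    (j : {rmorphism K -> L}) (p : {poly K}) : p != 0 ->
  (forall z, (map_poly i p).[z] = 0 -> exists w, i w = z) ->
  forall v, (map_poly j p).[v] = 0 -> exists2 w, j w = v & p.[w] = 0.
Proof.
move=> p0 im v pv; have [s pE] := closed_field_poly_normal (map_poly i p).
have lp0 : lead_coef p != 0 by rewrite lead_coef_eq0.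
have [t st] : exists t, s = map i t.
  have : forall z, z \in s -> exists w, i w = z.
    move=> z zs; apply: im; rewrite pE hornerZ (rootP _) ?mulr0 //.
    by rewrite root_prod_XsubC.
  elim: (s) => [|z s' IH] im'; first by exists [::].
  have [w <-] := im' z (mem_head _ _).
  have [|t ->] := IH; last by exists (w :: t).
  by move=> u us; apply: im'; rewrite inE us orbT.
have p_split : p = lead_coef p *: \prod_(w <- t) ('X - w%:P).
  apply: (map_poly_inj i); rewrite {1}pE st map_polyZ lead_coef_map /=; congr (_ *: _).
  by rewrite big_map rmorph_prod; apply: eq_bigr => w _ /=; rewrite map_polyXsubC.
move: pv; rewrite {1}p_split map_polyZ rmorph_prod /= hornerZ => /eqP.
rewrite mulf_eq0 fmorph_eq0 (negPf lp0) /= horner_prod prodf_seq_eq0.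
case/hasP=> w wt /=; rewrite map_polyXsubC hornerXsubC subr_eq0 => /eqP ->.
exists w => //; apply/rootP; rewrite p_split rootZ // root_prod_XsubC //.
Qed.

(** * Transport of a correspondence along a common subfield *)

Section Transfer.
Variables (K : fieldType) (k L : closedFieldType) (i : {rmorphism K -> k}).
Variables (j : {rmorphism K -> L}) (f g : {poly K}).
Hypothesis g' : g^`() != 0.
Hypothesis f' : f^`() != 0.
Hypothesis fC : forall c, f - c%:P != 0.
Local Notation fk := (map_poly i f).
Local Notation gk := (map_poly i g).
Hypothesis g'_roots : forall z, (gk^`()).[z] = 0 -> exists w, i w = z.
Hypothesis crit_path : forall c, critical_point fk gk c ->
  exists P : nat -> K, [/\ is_path fk gk (i \o P), i (P 0%N) = c & preperiodic (i \o P)].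

(** By [roots_lift] each critical point over L comes from an element of K that is critical over k.
    The path of that point lies in K; injectivity of [i] brings its relations down to K, and [j]
    carries them to L. *)
Lemma PCC_transfer : PCC (map_poly j f) (map_poly j g).
Proof.
have crit_im c : critical_point fk gk c -> exists w, i w = c.
  by move=> /crit_path[P [_ P0 _]]; exists (P 0%N).
have conclude (w : K) : critical_point fk gk (i w) ->
    exists P, is_path (map_poly j f) (map_poly j g) P /\ P 0%N = j w /\ preperiodic P.
  move=> /crit_path[P [pathP P0 [n [m [nm PE]]]]].
  exists (j \o P); split.
    move=> t; have := pathP t; rewrite /in_corr /= !horner_map.
    by move=> /fmorph_inj ->.
  split; first by rewrite /= (fmorph_inj i P0).
  by exists n, m; split=> // t; have := PE t => /= /fmorph_inj ->.
move=> c [fc|[b [gb g'b]]].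
  rewrite deriv_map in fc.
  have [|w <- f'w] := roots_lift (i := i) f' _ fc.
    by move=> z; rewrite -deriv_map => fz; apply: crit_im; left.
  by apply: conclude; left; rewrite deriv_map horner_map f'w rmorph0.
rewrite deriv_map in g'b.
have [|v vb g'v] := roots_lift (i := i) g' _ g'b.
  by move=> z; rewrite -deriv_map; apply: g'_roots.
have crit z : fk.[z] = gk.[i v] -> critical_point fk gk z.
  move=> fz; right; exists (i v); split=> //.
  by rewrite deriv_map horner_map g'v rmorph0.
have [||w wc fw] := @roots_lift K k L i j (f - (g.[v])%:P) (fC _) _ c.
- move=> z; rewrite rmorphB /= map_polyC hornerD hornerN hornerC.
  by move/eqP; rewrite subr_eq0 => /eqP fz; apply/crit_im/crit; rewrite horner_map.
- rewrite rmorphB /= map_polyC hornerD hornerN hornerC -gb -vb horner_map.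
  by rewrite subrr.
rewrite -wc; apply: conclude; apply: crit; rewrite !horner_map; congr (i _).
by move/eqP: fw; rewrite hornerD hornerN hornerC subr_eq0 => /eqP.
Qed.
End Transfer.

Section AlgebraicClosure.
Variables (k : closedFieldType) (ch0 : [pchar k] =i pred0).
Local Notation alg := (@algebraic k : set k).

Lemma algebraic_subring : subring alg.
Proof.
have [phi phiE] := ratr_rmorphism ch0.
have algE z : algebraic z <-> algebraicOver phi z.
  by split=> [[p [p0 pz]]|[p p0 pz]]; exists p; rewrite ?(eq_map_poly phiE) // in pz *;
    split=> //; rewrite -(eq_map_poly phiE).
split=> [|u v /algE au /algE av|u v /algE au /algE av]; apply/algE.
- exact: algebraic1.
- exact: algebraic_sub.
- exact: algebraic_mul.
Qed.

Lemma algebraic_root (p : {poly k}) z : p != 0 ->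
  (forall i, algebraic p`_i) -> p.[z] = 0 -> algebraic z.
Proof.
have [phi phiE] := ratr_rmorphism ch0.
have algE w : algebraic w <-> algebraicOver phi w.
  by split=> [[q [q0 qz]]|[q q0 qz]]; exists q; rewrite ?(eq_map_poly phiE) // in qz *;
    split=> //; rewrite -(eq_map_poly phiE).
move=> p0 algp pz; apply/algE/integral_algebraic; apply: (integral_root p0).
  exact/rootP.
by move=> _ /(nthP 0)[n _ <-]; apply/integral_algebraic/algE.
Qed.

Lemma algebraic_coefs_horner (p : {poly k}) z :
  (forall i, algebraic p`_i) -> algebraic z -> algebraic p.[z].
Proof.
move=> algp algz; rewrite horner_coef; apply: (subring_sum algebraic_subring) => i _.
by apply: (subringM algebraic_subring) => //; apply: (subringX algebraic_subring).
Qed.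

Lemma algebraic_normpoly d (a : nat -> k) : (0 < d)%N ->
  (forall i, (1 <= i < d)%N -> algebraic (a i)) -> forall i, algebraic (normpoly d a)`_i.
Proof.
move=> d0 alga i; have := size_normpoly d a; have [lt_i|] := ltnP i d; last first.
  rewrite leq_eqVlt => /orP[/eqP <-|di] sz.
    have := monicP (monic_normpoly d a); rewrite /lead_coef sz /= => ->.
    exact: (subring1 algebraic_subring).
  by rewrite nth_default ?sz //; apply: (subring0 algebraic_subring).
move=> _; case: i lt_i => [|i] lt_i; last by rewrite coef_normpoly //; apply: alga.
by rewrite -horner_coef0 normpoly_at0 //; apply: (subring0 algebraic_subring).
Qed.

Lemma algebraic_sub_const (p : {poly k}) c i :
  (forall i, algebraic p`_i) -> algebraic c -> algebraic (p - c%:P)`_i.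
Proof.
move=> algp algc; rewrite coefB coefC; apply: (subringB algebraic_subring) => //.
by case: (i == 0%N) => //; apply: (subring0 algebraic_subring).
Qed.

Lemma algebraic_deriv (p : {poly k}) i :
  (forall i, algebraic p`_i) -> algebraic (p^`())`_i.
Proof.
move=> algp; rewrite coef_deriv -mulr_natr; apply: (subringM algebraic_subring) => //.
exact: (subring_nat algebraic_subring).
Qed.

Lemma poly_roots_seq (p : {poly k}) : p != 0 ->
  exists s : seq k, forall z, (z \in s) = (p.[z] == 0).
Proof.
move=> p0; have [s pE] := closed_field_poly_normal p; exists s => z.
by rewrite -[RHS]/(root p z) pE rootZ ?lead_coef_eq0 // root_prod_XsubC.
Qed.
End AlgebraicClosure.

Lemma normpoly_sub_const_neq0 (k : fieldType) d (a : nat -> k) c : (0 < d)%N ->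
  normpoly d a - c%:P != 0.
Proof.
move=> d0; rewrite -size_poly_gt0 size_polyDl ?size_normpoly //.
by rewrite size_polyN; apply: leq_ltn_trans (size_polyC_leq1 _) _.
Qed.

Lemma deriv_normpoly_neq0 (k : fieldType) d (a : nat -> k) : [pchar k] =i pred0 ->
  (0 < d)%N -> (normpoly d a)^`() != 0.
Proof.
move=> ch0 d0; apply: contraNneq (natr_neq0_pchar0 ch0 d0) => p0.
have := congr1 (fun p : {poly k} => p`_d.-1) p0; rewrite coef_deriv coef0 prednK //.
by have := monicP (monic_normpoly d a); rewrite /lead_coef size_normpoly /= => -> ->.
Qed.

Section Conjugate.
Variables (d e : nat) (k : closedFieldType) (ch0 : [pchar k] =i pred0).
Hypothesis (e0 : (0 < e)%N) (ed : (e < d)%N).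
Variables (a b : nat -> k).
Hypothesis alga : forall i, (1 <= i < d)%N -> algebraic (a i).
Hypothesis algb : forall i, (1 <= i < e)%N -> algebraic (b i).
Local Notation f := (normpoly d a).
Local Notation g := (normpoly e b).
Hypothesis pcc : PCC f g.

Let d0 : (0 < d)%N. Proof. by apply: leq_trans ed. Qed.
Let algf := algebraic_normpoly ch0 d0 alga.
Let algg := algebraic_normpoly ch0 e0 algb.

Lemma critical_algebraic c : critical_point f g c -> algebraic c.
Proof.
case=> [fc|[v [gv g'v]]].
  apply: (algebraic_root ch0 (deriv_normpoly_neq0 a ch0 d0)) fc => i.
  exact: algebraic_deriv.
apply: (algebraic_root ch0 (normpoly_sub_const_neq0 a g.[v] d0)) => [i|]; last first.
  by rewrite hornerD hornerN hornerC gv subrr.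
apply: algebraic_sub_const => //; apply: algebraic_coefs_horner => //.
apply: (algebraic_root ch0 (deriv_normpoly_neq0 b ch0 e0)) g'v => n.
exact: algebraic_deriv.
Qed.

Lemma path_algebraic P : is_path f g P -> algebraic (P 0%N) -> forall n, algebraic (P n).
Proof.
move=> pathP P0; elim=> // n IH.
apply: (algebraic_root ch0 (normpoly_sub_const_neq0 b f.[P n] e0)) => [i|].
  by apply: algebraic_sub_const => //; apply: algebraic_coefs_horner.
by rewrite hornerD hornerN hornerC (pathP n) subrr.
Qed.

Lemma critical_seq : exists s : seq k, forall c, c \in s <-> critical_point f g c.
Proof.
have [s2 s2E] := poly_roots_seq (deriv_normpoly_neq0 b ch0 e0).
have [s sE] : exists s : seq k, forall z,
    (z \in s) = ((f^`() * \prod_(v <- s2) (f - (g.[v])%:P)).[z] == 0).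
  apply: poly_roots_seq; rewrite mulf_neq0 ?deriv_normpoly_neq0 //.
  by rewrite prodf_seq_neq0; apply/allP => v _ /=; apply: normpoly_sub_const_neq0.
exists s => c; rewrite sE hornerM mulf_eq0 horner_prod prodf_seq_eq0; split.
  case/orP => [/eqP|/hasP[v]]; first by left.
  rewrite s2E /= hornerD hornerN hornerC subr_eq0 => /eqP g'v /eqP fc.
  by right; exists v.
case=> [->|[v [gv g'v]]]; first by rewrite eqxx.
apply/orP; right; apply/hasP; exists v; first by rewrite s2E g'v.
by rewrite /= hornerD hornerN hornerC gv subrr.
Qed.

(** There are finitely many critical points, and each chosen path has finitely many points, so a
    finite list of algebraic elements, to be adjoined to a common field, carries all the paths. *)
Lemma critical_paths_seq : exists zs : seq k, (forall z, z \in zs -> algebraic z) /\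
  forall c, critical_point f g c -> exists P : nat -> k,
    [/\ is_path f g P, P 0%N = c, preperiodic P & forall n, P n \in zs].
Proof.
have [s sE] := critical_seq.
suff [zs [algz zsP]] : exists zs : seq k, (forall z, z \in zs -> algebraic z) /\
    forall c, c \in s -> exists P : nat -> k,
    [/\ is_path f g P, P 0%N = c, preperiodic P & forall n, P n \in zs].
  by exists zs; split=> // c /sE; apply: zsP.
have : forall c, c \in s -> critical_point f g c by move=> c /sE.
elim: (s) => [|c t IH] crit; first by exists [::].
have [|zs [algz zsP]] := IH; first by move=> u ut; apply: crit; rewrite inE ut orbT.
have cc := crit c (mem_head _ _).
have [P [pathP [P0 prepP]]] := pcc cc; have [m _ finP] := preperiodic_finite prepP.
exists (map P (iota 0 m) ++ zs); split.
  move=> z; rewrite mem_cat => /orP[/mapP[n _ ->]|/algz //].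
  by apply: path_algebraic => //; rewrite P0; apply: critical_algebraic.
move=> u; rewrite inE => /orP[/eqP ->|/zsP[R [pathR R0 prepR Rzs]]].
  exists P; split=> // n; have [n' n'm ->] := finP n.
  by rewrite mem_cat map_f // mem_iota.
by exists R; split=> // n; rewrite mem_cat Rzs orbT.
Qed.

(** Makes every conjugate r of a coefficient x a coefficient of a postcritically constrained
    correspondence over L, to which the bounds at the places of L apply. The common field holds x
    matched with r, all coefficients, the zeros of g' and the chosen paths. *)
Lemma PCC_conjugate (L : closedFieldType) (q : {poly rat}) (x : k) (r : L) :
  [pchar L] =i pred0 -> irreducible_poly q ->
  root (map_poly ratr q) x -> root (map_poly ratr q) r ->
  exists a' b' : nat -> L, [/\ PCC (normpoly d a') (normpoly e b'),
    forall i, (1 <= i < d)%N -> a i = x -> a' i = r &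
    forall i, (1 <= i < e)%N -> b i = x -> b' i = r].
Proof.
move=> chL0 irr qx qr.
have [s2 s2E] := poly_roots_seq (deriv_normpoly_neq0 b ch0 e0).
have [zs [algz zsP]] := critical_paths_seq.
pose cs := [seq a i | i <- iota 1 d.-1] ++ [seq b i | i <- iota 1 e.-1].
have range n m : (0 < n)%N -> (1 <= m < n)%N -> m \in iota 1 n.-1.
  by move=> n0; rewrite mem_iota; case: n n0.
have range' n m : (0 < n)%N -> m \in iota 1 n.-1 -> (1 <= m < n)%N.
  by move=> n0; rewrite mem_iota; case: n n0.
have [|K [i [j [[w iw jw] imz]]]] := common_field ch0 chL0 irr qx qr (zs := cs ++ s2 ++ zs).
  move=> z; rewrite !mem_cat -orbA => /or4P[/mapP[n nd ->]|/mapP[n nd ->]||/algz //].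
  - exact/alga/range'.
  - exact/algb/range'.
  rewrite s2E => /eqP g'z; apply: (algebraic_root ch0 (deriv_normpoly_neq0 b ch0 e0)) g'z => n.
  exact: algebraic_deriv.
(* The value 0 outside the index range is never read by [normpoly]. *)
have [a0 a0E] : {a0 : nat -> K & forall n, (1 <= n < d)%N -> i (a0 n) = a n}.
  apply: (choice (P := fun n v => (1 <= n < d)%N -> i v = a n)) => n.
  case: (boolP (1 <= n < d)%N) => [nd|_]; last by exists 0.
  by have [|v <-] := imz (a n); [rewrite !mem_cat map_f ?range | exists v].
have [b0 b0E] : {b0 : nat -> K & forall n, (1 <= n < e)%N -> i (b0 n) = b n}.
  apply: (choice (P := fun n v => (1 <= n < e)%N -> i v = b n)) => n.
  case: (boolP (1 <= n < e)%N) => [nd|_]; last by exists 0.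
  have [|v <-] := imz (b n); last by exists v.
  by rewrite !mem_cat (map_f b (range _ _ e0 nd)) orbT.
have fE := map_normpoly a0E; have gE := map_normpoly b0E.
have chK := pchar0_rmorph i ch0.
exists (j \o a0), (j \o b0); split.
- rewrite -(map_normpoly (phi := j) (a := a0)) // -(map_normpoly (phi := j) (a := b0)) //.
  apply: (@PCC_transfer K k L i j).
  + exact: deriv_normpoly_neq0.
  + exact: deriv_normpoly_neq0.
  + by move=> c; apply: normpoly_sub_const_neq0.
  + by rewrite gE => z g'z; apply: imz; rewrite !mem_cat s2E g'z eqxx orbT.
  rewrite fE gE => c /zsP[P [pathP P0 prepP Pzs]].
  have [P' P'E] : {P' : nat -> K & forall n, i (P' n) = P n}.
    apply: (choice (P := fun n v => i v = P n)) => n.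
    by apply: imz; rewrite !mem_cat Pzs !orbT.
  have eP : i \o P' = P by apply/funext.
  by exists P'; rewrite eP P'E.
- by move=> n nd ax; rewrite /= -jw; congr (j _); apply: (fmorph_inj i); rewrite a0E // ax.
- by move=> n nd bx; rewrite /= -jw; congr (j _); apply: (fmorph_inj i); rewrite b0E // bx.
Qed.
End Conjugate.

(** * Heights *)

(** As d is positive, the factorial is at least 2 and absorbs both terms of the triangle
    inequality. *)
Lemma absolute_value_size d : (0 < d)%N ->
  is_size d (fun x y : algC => `|x| <= `|y|) (d.+1)`!%:R.
Proof.
move=> d0; have M1 : (1 : algC) <= (d.+1)`!%:R by rewrite ler1n fact_gt0.
split.
- by move=> y x z; apply: le_trans.
- by move=> x y; case/orP: (real_leVge (normr_real x) (normr_real y)); [left|right].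
- by move=> x y u v xy uv; rewrite !normrM ler_pM.
- by move=> x; rewrite normr0 normr_le0 => /eqP.
- by move=> x; rewrite normr0 normr_ge0.
- by rewrite normr1 normr_nat.
- move=> x y z xz yz; rewrite normrM normr_nat; apply: le_trans (ler_normD _ _) _.
  apply: le_trans (_ : 2%:R * `|z| <= _); first by rewrite mulr_natl mulr2n lerD.
  rewrite ler_wpM2r // ler_nat; case: (d) d0 => // d' _.
  by rewrite factS; apply: leq_trans (leq_pmulr _ (fact_gt0 _)).
- move=> n /andP[n0 _]; rewrite normr1 -natrM normr_nat ler1n.
  by rewrite muln_gt0 fact_gt0.
Qed.

Lemma pchar_algC : [pchar algC] =i pred0.
Proof. exact: pchar_num. Qed.

(** * Integer minimal polynomials *)

Section IntegerPolynomials.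
Variables (F : fieldType) (ch0 : [pchar F] =i pred0).

Lemma map_ratr_intr (q : {poly int}) :
  map_poly ratr (map_poly intr q : {poly rat}) = map_poly intr q :> {poly F}.
Proof.
have [phi phiE] := ratr_rmorphism ch0.
rewrite -(eq_map_poly phiE) -map_poly_comp; apply: eq_map_poly => z /=.
by rewrite rmorph_int.
Qed.

Lemma irreducible_root_dvdp (q p : {poly rat}) (x : F) : irreducible_poly q ->
  root (map_poly ratr q) x -> root (map_poly ratr p) x -> q %| p.
Proof.
have [phi phiE] := ratr_rmorphism ch0.
rewrite -!(eq_map_poly phiE) => irr qx px.
have gx : root (map_poly phi (gcdp q p)) x by rewrite gcdp_map root_gcd qx px.
have sg : size (gcdp q p) != 1%N.
  apply/eqP => s1; move: gx; have /size1_polyC gE : (size (gcdp q p) <= 1)%N by rewrite s1.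
  rewrite gE map_polyC /= rootC fmorph_eq0 => /eqP c0.
  by move: s1; rewrite gE c0 size_poly0.
have /eqp_dvdl <- := irr.2 _ sg (dvdp_gcdl _ _).
exact: dvdp_gcdr.
Qed.

Lemma exists_int_minpoly (x : F) : algebraic x -> exists q, int_minpoly q x.
Proof.
have [phi phiE] := ratr_rmorphism ch0.
move=> [p [p0 px]]; have algx : algebraicOver phi x.
  by exists p => //; rewrite (eq_map_poly phiE).
have [h [irr mh] hx] := exists_minimal_poly algx.
have [q0 [c c0 hE]] := rat_poly_scale h.
have q00 : q0 != 0.
  by apply: contraTneq mh => q0E; rewrite hE q0E rmorph0 scaler0 monicE lead_coef0 eq_sym oner_eq0.
pose q := zprimitive q0.
have [u u0 qE] : exists2 u : rat, u != 0 & map_poly intr q = u *: h.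
  exists (c%:~R * (zcontents q0)%:~R^-1).
    by rewrite mulf_neq0 ?invr_eq0 ?intr_eq0 ?zcontents_eq0.
  have := zpolyEprim q0; rewrite -/q => /(congr1 (map_poly (intr : int -> rat))).
  rewrite map_polyZ /= => q0E; rewrite hE q0E scalerA scalerA.
  by rewrite [X in X *: _](_ : _ = 1) ?scale1r //; field; rewrite !intr_eq0 c0 zcontents_eq0.
exists q; split.
- by rewrite zcontents_primitive q00.
- by rewrite -sgz_gt0 sgz_lead_primitive q00.
- rewrite -[map_poly _ _]/(map_poly intr q) qE; split=> [|r sr].
    by rewrite size_scale //; case: irr.
  by rewrite dvdpZr // => /(irr.2 _ sr) rh; apply: eqp_trans rh _; rewrite eqp_sym eqp_scale.
- rewrite -[map_poly _ _]/(map_poly intr q) -map_ratr_intr -(eq_map_poly phiE) qE.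
  by rewrite map_polyZ rootZ // fmorph_eq0.
Qed.

Lemma integral_algebraic_scale (c : nat) (x : F) : (0 < c)%N ->
  integral_over_Z (c%:R * x) -> algebraic x.
Proof.
have [phi phiE] := ratr_rmorphism ch0.
move=> c0 [p mp px].
have algc : algebraicOver phi c%:R by rewrite -(rmorph_nat phi c); apply: algebraic_id.
have algcx : algebraicOver phi (c%:R * x).
  exists (map_poly intr p); first by exact/monic_neq0/monic_map.
  by rewrite (eq_map_poly phiE) map_ratr_intr; apply/rootP.
have [r r0 rx] : algebraicOver phi x.
  rewrite -[x](mulKf (natr_neq0_pchar0 ch0 c0)) mulrC.
  exact: algebraic_div.
by exists r; rewrite -(eq_map_poly phiE).
Qed.
End IntegerPolynomials.

Lemma root_scaled_poly (F : fieldType) (ch0 : [pchar F] =i pred0) (p : {poly int})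
    (c : nat) (x : F) :
  root (map_poly ratr (map_poly intr p \Po (c%:R *: 'X) : {poly rat})) x
    = ((map_poly intr p).[c%:R * x] == 0).
Proof.
have [phi phiE] := ratr_rmorphism ch0.
rewrite -(eq_map_poly phiE) map_comp_poly.
rewrite [map_poly phi (map_poly intr p)](eq_map_poly phiE) map_ratr_intr //.
by rewrite map_polyZ map_polyX /= rmorph_nat rootE horner_comp hornerZ hornerX.
Qed.

Lemma lead_coef_dvd_scale (c : nat) (q : {poly int}) (s : seq algC) :
  (0 < c)%N -> zcontents q = 1 -> lead_coef q != 0 ->
  map_poly intr q = (lead_coef q)%:~R *: \prod_(z <- s) ('X - z%:P) ->
  (forall z, z \in s -> c%:R * z \in Aint) ->
  (lead_coef q %| (c ^ size s)%:Z)%Z.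
Proof.
move=> c0 prim lq0 qE cs.
have coefE i : exists m : int, lead_coef q * m = (c ^ size s)%:Z * q`_i.
  (* The coefficients of P = c^n q / lc(q) are rational algebraic integers. *)
  pose P := \prod_(z <- s) (c%:R *: 'X - (c%:R * z)%:P) : {poly algC}.
  have PE : (lead_coef q)%:~R *: P = (c ^ size s)%:R *: map_poly intr q.
    have -> : P = (c ^ size s)%:R *: \prod_(z <- s) ('X - z%:P).
      rewrite natrX; elim: (s) @P => [|z t IH] /=; first by rewrite !big_nil expr0 scale1r.
      rewrite !big_cons exprS.
      have -> : c%:R *: 'X - (c%:R * z)%:P = c%:R *: ('X - z%:P) :> {poly algC}.
        by rewrite scalerBr -[c%:R *: z%:P]mul_polyC polyCM.
      by rewrite -scalerA scalerAr -IH -scalerAl.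
    by rewrite qE !scalerA mulrC.
  have Pint : P \is a polyOver Aint.
    rewrite /P big_seq; apply: rpred_prod => z zs; apply: rpredB.
      by apply: polyOverZ; [rewrite rpred_nat | rewrite polyOverX].
    by rewrite polyOverC cs.
  have lC0 : (lead_coef q)%:~R != 0 :> algC by rewrite intr_eq0.
  have Pi : P`_i = (c ^ size s)%:R * (q`_i)%:~R / (lead_coef q)%:~R.
    have := congr1 (fun r : {poly algC} => r`_i) PE; rewrite !coefZ coef_map /= => <-.
    by rewrite mulrC mulKf.
  have /intrP[m mE] : P`_i \in Num.int.
    apply: Cint_rat_Aint; last exact: (polyOverP Pint).
    by rewrite Pi; apply: rpred_div; [apply: rpredM|]; rewrite ?rpred_nat ?rpred_int.
  exists m; apply: (@intr_inj algC); rewrite !rmorphM /= -mE Pi mulrCA.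
  by rewrite mulfV // mulr1.
(* The leading coefficient divides all coefficients of c^n q, whose content is c^n because q is
   primitive. *)
have : (lead_coef q %| zcontents ((c ^ size s)%:Z *: q))%Z.
  rewrite dvdz_contents; apply/polyOverP => i; rewrite coefZ.
  by have [m <-] := coefE i; rewrite dvdz_mulr.
by rewrite zcontentsZ prim mulr1.
Qed.

Section Heights.
Variables (k : closedFieldType) (ch0 : [pchar k] =i pred0) (c : nat) (x : k).
Hypothesis c0 : (0 < c)%N.
Hypothesis cx_int : integral_over_Z (c%:R * x).
Hypothesis conj_le : forall (q : {poly rat}) (z : algC), irreducible_poly q ->
  root (map_poly ratr q) x -> root (map_poly ratr q) z -> `|z| <= c%:R.

(** With n the degree of x, the leading coefficient divides c^n because c z is an algebraic integer
    for each conjugate z, and the n factors max(1, |z|) are at most c each. Together the Mahler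
    measure is at most c^(2n). *)
Lemma height_le_conjugates : height_le (c ^ 2) x.
Proof.
move=> q [prim lq_gt0 irr qx] s qE.
rewrite -[map_poly _ _]/(map_poly intr q) in irr qx qE.
have lq0 : lead_coef q != 0 by rewrite gt_eqF.
have ss : size s = (size q).-1.
  have <- : size (map_poly intr q : {poly algC}) = size q.
    by rewrite size_map_inj_poly //; apply: intr_inj.
  by rewrite qE size_scale ?intr_eq0 // size_prod_XsubC.
have qroot z : z \in s -> root (map_poly ratr (map_poly intr q : {poly rat})) z.
  by move=> zs; rewrite map_ratr_intr ?qE ?rootZ ?intr_eq0 ?root_prod_XsubC //; exact: pchar_algC.
have qx' : root (map_poly ratr (map_poly intr q : {poly rat})) x by rewrite map_ratr_intr.
have z_le z : z \in s -> `|z| <= c%:R by move=> /qroot; apply: conj_le.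
(* The minimal polynomial of x divides p(cX), so the monic equation of c x holds for each c z as
   well. *)
have cz_int z : z \in s -> c%:R * z \in Aint.
  have [p mp px] := cx_int; move=> /qroot qz.
  have qp : (map_poly intr q : {poly rat}) %| (map_poly intr p \Po (c%:R *: 'X)).
    by apply: (irreducible_root_dvdp ch0 irr qx'); rewrite root_scaled_poly // px.
  have [r pE] := dvdpP _ _ qp.
  have : root (map_poly ratr (map_poly intr p \Po (c%:R *: 'X) : {poly rat})) z.
    by rewrite pE rmorphM /= rootM qz orbT.
  rewrite root_scaled_poly; last exact: pchar_algC.
  move=> pz; apply: (root_monic_Aint pz); first exact: monic_map.
  by apply/polyOverP => i; rewrite coef_map /= intr_int.
have lq_le : `|(lead_coef q)%:~R : algC| <= c%:R ^+ size s.
  have := lead_coef_dvd_scale c0 prim lq0 qE cz_int.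
  rewrite dvdzE => /dvdn_leq; rewrite absz_nat expn_gt0 c0 => /(_ isT) le_l.
  by rewrite -natrX -intr_norm -abszE ler_nat.
have c1 : 1 <= c%:R :> algC by rewrite ler1n.
have max_bound z : z \in s -> 0 <= Num.max 1 `|z| <= c%:R.
  by rewrite /Num.max => /z_le zc; case: ifP; rewrite ?normr_ge0 ?ler01.
have prod_le : 0 <= \prod_(z <- s) Num.max 1 `|z| <= c%:R ^+ size s.
  elim: (s) max_bound => [|z t IH] mb; first by rewrite big_nil expr0 ler01 lexx.
  rewrite big_cons exprS; have /andP[m0 mc] := mb z (mem_head _ _).
  have /andP[p0 pc] : 0 <= \prod_(u <- t) Num.max 1 `|u| <= c%:R ^+ size t.
    by apply: IH => u ut; apply: mb; rewrite inE ut orbT.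
  by rewrite mulr_ge0 // ler_pM.
have /andP[p0 pc] := prod_le.
by rewrite natrX exprAC expr2 -ss ler_pM.
Qed.
End Heights.

(** * Northcott finiteness *)

Lemma seqs_finite (T : eqType) (alphabet : seq T) n :
  exists S : seq (seq T), forall s, size s = n -> {subset s <= alphabet} -> s \in S.
Proof.
elim: n => [|n [S SP]]; first by exists [:: [::]] => -[].
exists [seq x :: s | x <- alphabet, s <- S] => -[//|x s] [sn] sub.
apply/allpairsP; exists (x, s); split=> //=; first by apply/sub/mem_head.
by apply: SP => // y ys; apply: sub; rewrite inE ys orbT.
Qed.

Lemma bounded_int_polys_finite n N :
  exists S : seq {poly int}, forall q : {poly int},
    (size q <= n)%N -> (forall i, (absz (q`_i)%R <= N)%N) -> q \in S.
Proof.
pose alphabet := [seq (m%:Z : int) | m <- iota 0 N.+1] ++ [seq - (m%:Z) | m <- iota 0 N.+1].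
have [S SP] := seqs_finite alphabet n.
exists [seq Poly s | s <- S] => q sq qN; apply/mapP; exists (mkseq (fun i => q`_i) n).
  apply: SP; first by rewrite size_mkseq.
  move=> _ /mapP[i _ ->]; rewrite mem_cat.
  have := qN i; case: (q`_i) => m mN; apply/orP; [left|right].
    by apply/mapP; exists m => //; rewrite mem_iota.
  by apply/mapP; exists m.+1; rewrite ?NegzE // mem_iota.
apply/polyP => i; rewrite coef_Poly; have [lt_i|ge_i] := ltnP i n.
  by rewrite nth_mkseq.
by rewrite !nth_default ?size_mkseq // (leq_trans sq).
Qed.

(** Multiplication by X - z adds two terms, each at most max(1, |z|) times the previous bound. *)
Lemma coef_mahler_bound (s : seq algC) i :
  `|(\prod_(z <- s) ('X - z%:P))`_i| <= 2%:R ^+ size s * \prod_(z <- s) Num.max 1 `|z|.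
Proof.
elim: s i => [|z s IH] i.
  by rewrite !big_nil coef1 expr0 mulr1; case: (i == 0%N); rewrite ?normr1 ?normr0.
set p := \prod_(z <- s) ('X - z%:P) in IH *.
set m := \prod_(z <- s) Num.max 1 `|z| in IH *.
rewrite !big_cons -/p -/m mulrBl coefB coefXM coefCM exprS.
set x := Num.max 1 `|z|.
have [x1 xz] : 1 <= x /\ `|z| <= x.
  have := real_leVge (@real1 algC) (normr_real z).
  by rewrite /x /Num.max; case: ifP => [/ltW|] //; rewrite real_ltNge ?real1 // => /negbFE.
have K0 : 0 <= 2%:R ^+ size s * m by apply: le_trans (normr_ge0 _) (IH 0%N).
apply: le_trans (ler_normB _ _) _.
have -> : 2%:R * 2%:R ^+ size s * (x * m) = x * (2%:R ^+ size s * m) + x * (2%:R ^+ size s * m).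
  by rewrite -mulr2n -mulr_natl; ring.
apply: lerD; last by rewrite normrM ler_pM.
apply: le_trans (_ : 2%:R ^+ size s * m <= _); last by rewrite ler_peMl.
by case: (i == 0%N); rewrite ?normr0.
Qed.

(** Degree and Mahler measure bound the coefficients of the integer minimal polynomial, which leaves
    finitely many polynomials, each with finitely many roots. *)
Lemma northcott (k : closedFieldType) (ch0 : [pchar k] =i pred0) (B D : nat) :
  exists s : seq k, forall x, alg_deg_le D x -> height_le B x -> x \in s.
Proof.
(* The successor keeps the base positive even for B = 0, so its powers grow with the degree up to
   D. *)
have [S SP] := bounded_int_polys_finite D.+1 ((2 * B).+1 ^ D).
have [s sE] : exists s : seq k, forall z,
    (z \in s) = ((\prod_(q <- S | map_poly intr q != 0 :> {poly k}) map_poly intr q).[z] == 0).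
  by apply: poly_roots_seq; rewrite prodf_seq_neq0; apply/allP => q _; apply/implyP.
exists s => x [p [p0 [sp px]]] hx.
have algx : algebraic x by exists p.
have [q qmin] := exists_int_minpoly ch0 algx.
have [prim lq_gt0 irr qx] := qmin.
rewrite -[map_poly _ _]/(map_poly intr q) in irr qx.
have lq0 : lead_coef q != 0 by rewrite gt_eqF.
have sq_rat : size (map_poly intr q : {poly rat}) = size q.
  by rewrite size_map_inj_poly //; apply: intr_inj.
have sqD : (size q <= D.+1)%N.
  rewrite -sq_rat; apply: leq_trans sp; apply: dvdp_leq => //.
  by apply: (irreducible_root_dvdp ch0 irr _ px); rewrite map_ratr_intr.
rewrite sE horner_prod prodf_seq_eq0; apply/hasP; exists q; last first.
  rewrite -[_.[x] == 0]/(root _ x) qx andbT.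
  apply: contra_neq (intr_neq0_pchar0 ch0 lq0) => q0.
  have := congr1 (fun p : {poly k} => p`_(size q).-1) q0.
  by rewrite coef_map coef0.
apply: SP => // i.
have [r qE] := closed_field_poly_normal (map_poly intr q : {poly algC}).
rewrite lead_coef_map_inj // in qE; last exact: intr_inj.
have sr : size r = (size q).-1.
  have <- : size (map_poly intr q : {poly algC}) = size q.
    by rewrite size_map_inj_poly //; apply: intr_inj.
  by rewrite qE size_scale ?intr_eq0 // size_prod_XsubC.
have hq := hx q qmin r qE.
have : `|(q`_i)%:~R : algC| <= ((2 * B) ^ (size q).-1)%:R.
  have -> : (q`_i)%:~R = (lead_coef q)%:~R * (\prod_(z <- r) ('X - z%:P))`_i :> algC.
    by rewrite -coefZ -qE coef_map.
  rewrite normrM expnMn natrM natrX natrX.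
  apply: le_trans (ler_wpM2l _ (coef_mahler_bound _ _)) _ => //.
  by rewrite mulrCA sr; apply: ler_wpM2l hq; rewrite exprn_ge0.
rewrite -intr_norm -abszE ler_nat => /leq_trans; apply.
apply: (@leq_trans ((2 * B).+1 ^ (size q).-1)); first by case: (_.-1) => // t; rewrite leq_exp2r.
rewrite leq_pexp2l //; clear -sqD; lia.
Qed.

Theorem theorem1p1 (d e : nat) (hed : (1 <= e)%N) (hde : (e < d)%N) :
  exists B : nat,
  forall k : closedFieldType, [pchar k] =i pred0 ->
    (forall a b : nat -> k, PCC (normpoly d a) (normpoly e b) ->
       (forall i, (1 <= i < d)%N -> algebraic (a i) /\ height_le B (a i)) /\
       (forall j, (1 <= j < e)%N -> algebraic (b j) /\ height_le B (b j)))
    /\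
    (forall D : nat, (1 <= D)%N ->
       exists s : seq (seq k * seq k),
       forall a b : nat -> k,
         PCC (normpoly d a) (normpoly e b) ->
         (forall i, (1 <= i < d)%N -> alg_deg_le D (a i)) ->
         (forall j, (1 <= j < e)%N -> alg_deg_le D (b j)) ->
         ([seq a i | i <- iota 1 d.-1], [seq b j | j <- iota 1 e.-1]) \in s).
Proof.
have d0 : (0 < d)%N by apply: leq_trans hde.
(* This c serves twice: it scales the coefficients to algebraic integers, and it bounds the absolute
   values of their conjugates. Hence the height bound c^2. *)
pose c := ((d.+1)`! ^ coef_exp d e)%N.
have c0 : (0 < c)%N by rewrite expn_gt0 fact_gt0.
exists (c ^ 2)%N => k ch0.
have bounds (a b : nat -> k) : PCC (normpoly d a) (normpoly e b) ->
    (forall i, (1 <= i < d)%N -> algebraic (a i) /\ height_le (c ^ 2) (a i)) /\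
    (forall j, (1 <= j < e)%N -> algebraic (b j) /\ height_le (c ^ 2) (b j)).
  move=> pcc; have [ia ib] := PCC_integral hed hde ch0 pcc.
  rewrite -natrX -/c in ia ib.
  have alga i : (1 <= i < d)%N -> algebraic (a i).
    by move=> id; apply: integral_algebraic_scale c0 _ => //; apply: ia.
  have algb i : (1 <= i < e)%N -> algebraic (b i).
    by move=> ie; apply: integral_algebraic_scale c0 _ => //; apply: ib.
  (* A conjugate z of a coefficient is itself a coefficient of a transported correspondence over
     [algC], where [coef_bound] applies with the ordinary absolute value. *)
  have conj x (q : {poly rat}) (z : algC) : irreducible_poly q ->
      root (map_poly ratr q) x -> root (map_poly ratr q) z ->
      (forall i, (1 <= i < d)%N -> a i = x -> `|z| <= c%:R) /\
      (forall j, (1 <= j < e)%N -> b j = x -> `|z| <= c%:R).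
    move=> irr qx qz.
    have [a' [b' [pcc' a'z b'z]]] := PCC_conjugate ch0 hed hde alga algb pcc pchar_algC irr qx qz.
    have [a'c b'c] := coef_bound pchar_algC hed hde (absolute_value_size d0) pcc'.
    rewrite /= -natrX normr_nat -/c in a'c b'c.
    by split=> i id; [move=> /(a'z i id) <- | move=> /(b'z i id) <-]; auto.
  split=> i id; (split; first by auto).
    apply: (height_le_conjugates ch0 c0 (ia i id)) => q z irr qx qz.
    by have [h _] := conj _ _ _ irr qx qz; apply: h id _.
  apply: (height_le_conjugates ch0 c0 (ib i id)) => q z irr qx qz.
  by have [_ h] := conj _ _ _ irr qx qz; apply: h id _.
split=> // D _; have [s sP] := northcott ch0 (c ^ 2) D.
(* All coefficients lie in the one finite list [s], so only finitely many tuples of the two fixed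
   lengths occur. *)
have [S SP] := seqs_finite s d.-1; have [R RP] := seqs_finite s e.-1.
exists [seq (u, v) | u <- S, v <- R] => a b pcc degA degB.
have [ha hb] := bounds a b pcc.
have range n m : (0 < n)%N -> m \in iota 1 n.-1 -> (1 <= m < n)%N.
  by move=> n0; rewrite mem_iota; case: n n0.
apply: allpairs_f.
  apply: SP => [|_ /mapP[i /(range _ _ d0) id ->]]; first by rewrite size_map size_iota.
  by apply: sP; [apply: degA | have [] := ha i id].
apply: RP => [|_ /mapP[i /(range _ _ hed) id ->]]; first by rewrite size_map size_iota.
by apply: sP; [apply: degB | have [] := hb i id].
Qed.
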